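(* Let $g_1,\dots,g_s\in\mathbb{R}[x_1,\dots,x_n]$, let $I\subset\mathbb{R}[x_1,\dots,x_n]$ be an ideal, and let $w\in\operatorname{Trop}(I)$. If $\operatorname{in}_w(I)$ is real radical and $\operatorname{in}_w(g_1),\dots,\operatorname{in}_w(g_s)$ form a preorder basis with respect to $\operatorname{in}_w(I)$, then $w\in\mathcal{L}(K_{\mathbb{R}^*})$, where $$K_{\mathbb{R}^*}=\{x\in(\mathbb{R}^* )^n : f(x)=0\ \text{for all } f\in I,\ \text{and } g_i(x)\ge 0\ \text{for all } i=1,\dots,s\}.$$
   Context: Notation: $\mathbb{R}^*=\mathbb{R}\setminus\{0\}$ and $\mathbb{R}_+$ denotes the positive reals. Initial forms: for $w\in\mathbb{R}^n$ and a nonzero polynomial $f=\sum_a f_a x^a$, $\deg_w(f)=\max\{w^Ta : f_a\ne0\}$ and $\operatorname{in}_w(f)=\sum_{a:\,w^Ta=\deg_w(f)}f_a x^a$; $\operatorname{in}_w(0)=0$. For an ideal $I$, $\operatorname{in}_w(I)=\langle \operatorname{in}_w(f): f\in I\rangle$. Tropical variety: $\operatorname{Trop}(I)=\{w\in\mathbb{R}^n : \operatorname{in}_w(I)\text{ contains no monomials}\}$. Real radical: an ideal $J\subset\mathbb{R}[x_1,\dots,x_n]$ is real radical if $J=\sqrt[\mathbb{R}]{J}$, where $\sqrt[\mathbb{R}]{J}=\{f : -f^{2m}\in\sum\mathbb{R}[x_1,\dots,x_n]^2+J\text{ for some integer } m\geq 1\}$; equivalently $\sqrt[\mathbb{R}]{J}$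 is the set of all polynomials vanishing on the real zero set of $J$. Preorder basis: polynomials $p_1,\dots,p_s$ form a preorder basis (PO-basis) with respect to an ideal $J$ if for all finite families of polynomials $y_{ej}\in\mathbb{R}[x_1,\dots,x_n]$ (with $e\in\{0,1\}^s$), $\sum_{e,j}p^e y_{ej}^2\in J$ implies $y_{ej}\in J$ for all $e,j$, where $p^e=p_1^{e_1}\cdots p_s^{e_s}$. Logarithmic limit set: for $V\subset(\mathbb{R}_+)^n$, $\mathcal{L}(V)$ is the set of $x\in\mathbb{R}^n$ for which there exist sequences $y(k)\in V$ and $t(k)\in(0,1)$ with $t(k)\to0$ and $\log_{1/t(k)}(y(k))\to x$ (logarithm taken coordinatewise). For $V\subset(\mathbb{R}^* )^n$, $\mathcal{L}(V):=\mathcal{L}(|V|)$, where $|V|=\{(|x_1|,\dots,|x_n|):x\in V\}$. *)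

(* Defs.v *)
From HB Require Import structures.
From mathcomp Require Import all_boot all_order all_algebra.
From mathcomp Require Import boolp classical_sets functions reals topology.
From mathcomp Require Import normedtype sequences exp.
(* The notations of mpoly and of MathComp-Analysis clash, so mpoly is imported
   without them: [mpoly n R] is the ring of polynomials in n variables over R,
   [multinom n] the type of exponent vectors, [mpolyX R m] the monomial x^m,
   [mcoeff m f] the coefficient of x^m in f, [meval v f] the value f(v). *)
From mathcomp Require Import -(notations) mpoly.

Set Implicit Arguments.
Unset Strict Implicit.
Unset Printing Implicit Defensive.

Import Order.TTheory GRing.Theory Num.Theory.
Import numFieldNormedType.Exports.

Local Open Scope classical_set_scope.
Local Open Scope ring_scope.

Section Ideals.
Variable A : comNzRingType.

(* Unlike [idealr] of ring_quotient, the unit ideal is allowed. *)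
Definition is_ideal (I : set A) : Prop :=
  [/\ I 0,
      forall a b, I a -> I b -> I (a + b)
    & forall c a, I a -> I (c * a)].

Definition ideal_gen (S : set A) : set A := smallest is_ideal S.

Definition sum_of_squares : set A :=
  [set a | exists qs : seq A, a = \sum_(q <- qs) q ^+ 2].

Definition real_radical_of (J : set A) : set A :=
  [set f | exists m : nat, (1 <= m)%N /\
     exists a b, [/\ sum_of_squares a, J b & - f ^+ (2 * m) = a + b]].

Definition real_radical (J : set A) : Prop := J = real_radical_of J.

(* [ys e] lists the y_{ej}; the number of indices j may depend on e. *)
Definition preorder_basis (s : nat) (p : 'I_s -> A) (J : set A) : Prop :=
  forall ys : {ffun 'I_s -> bool} -> seq A,
    J (\sum_(e : {ffun 'I_s -> bool}) \sum_(y <- ys e)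
         (\prod_(i < s) p i ^+ (e i)) * y ^+ 2) ->
    forall (e : {ffun 'I_s -> bool}) (y : A), y \in ys e -> J y.

End Ideals.

Section Initial.
Variables (R : realType) (n : nat).
Implicit Types (w : 'rV[R]_n) (f : mpoly n R) (I : set (mpoly n R)).

Definition wdot w (a : multinom n) : R := \sum_(i < n) w ord0 i * (a i)%:R.

(* The initial value of the iterated maximum belongs to the support of f
   when f != 0, so it does not affect the result; deg_w 0 is a junk value. *)
Definition deg_w w f : R :=
  \big[Num.max/wdot w (mlead f)]_(a <- msupp f) wdot w a.

Definition in_w w f : mpoly n R :=
  \sum_(a <- msupp f | wdot w a == deg_w w f) mcoeff a f *: mpolyX R a.

Definition in_w_ideal w I : set (mpoly n R) :=
  ideal_gen [set in_w w f | f in I].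

Definition Trop I : set 'rV[R]_n :=
  [set w | forall a : multinom n, ~ in_w_ideal w I (mpolyX R a)].

End Initial.

Section LogLimit.
Variables (R : realType) (n : nat).
Implicit Types (V : set 'rV[R]_n).

Definition log_base (b y : R) : R := ln y / ln b.

(* Meaningful for V contained in the positive orthant. *)
Definition log_limit_pos V : set 'rV[R]_n :=
  [set x | exists (y : nat -> 'rV[R]_n) (t : nat -> R),
     [/\ forall k, V (y k),
         forall k, 0 < t k < 1,
         t k @[k --> \oo] --> (0 : R)
       & map_mx (log_base (t k)^-1) (y k) @[k --> \oo] --> x]].

Definition abs_set V : set 'rV[R]_n :=
  [set map_mx (fun c : R => `|c|) x | x in V].

(* For V contained in (R^* )^n. *)
Definition log_limit V : set 'rV[R]_n := log_limit_pos (abs_set V).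

Definition K_star (s : nat) (I : set (mpoly n R)) (g : 'I_s -> mpoly n R) :
    set 'rV[R]_n :=
  [set x | [/\ forall i, x ord0 i != 0,
               forall f, I f -> meval (x ord0) f = 0
             & forall i, 0 <= meval (x ord0) (g i)]].

End LogLimit.

(* Main.v *)
Require Import Defs.
From HB Require Import structures.
From mathcomp Require Import all_boot all_order all_algebra.
From mathcomp Require Import boolp classical_sets functions reals topology.
From mathcomp Require Import normedtype sequences exp.
From mathcomp Require Import all_field zify ring lra.
From mathcomp Require Import generic_quotient ring_quotient fraction.
From mathcomp Require Import polyrcf qe_rcf_th.
From mathcomp Require Import -(notations) mpoly.

(** Let [J = in_w(I)] and adjoin a parameter [T] of weight [1].  For the
    constraints [g_i >= 0], [T >= M] and [T^a <= |x_i|^N <= T^b], where the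
    integers [a < N w_i < b] are close to [N w_i], no relation
    [-1 = sum of products of constraints times squares, modulo I] exists: in
    such a relation the terms of top weighted degree give a relation among the
    [in_w(g_i)] modulo [J] (up to monomial factors), so the preorder basis
    hypothesis puts the top forms of the squared polynomials into [J].  They
    are then initial forms of elements of [I] and can be cancelled.  As [J] is
    finitely generated, the degree drops by at least a fixed gap for new terms,
    so after finitely many steps the top degree is that of the left-hand side,
    a monomial, which [J] does not contain.

    Hence the constraints generate a proper preordering, which extends to a
    prime cone.  Passing to a countable subring, the cone is realised in a real
    closed field: inside an algebraically closed field, a cone that is maximal
    is the set of nonnegative elements of a real closed subfield.  Tarski
    transfer turns this point into a real point [x] with [T >= M] on which the
    constraints hold, so that [log_T |x_i|] is within [2 / N] of [w_i]; let
    [M] and [N] tend to infinity. *)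

Set Implicit Arguments.
Unset Strict Implicit.
Unset Printing Implicit Defensive.

Import Order.TTheory GRing.Theory Num.Theory.
Import numFieldNormedType.Exports.

Local Open Scope classical_set_scope.
Local Open Scope ring_scope.

(** * Tarski transfer between real closed fields *)

Section CindexField.
Variable E : rcfType.
Implicit Types p q : {poly E}.

Lemma cindexRZ c p q : cindexR (c *: p) q = sgz c * cindexR p q.
Proof.
by rewrite /cindexR big_distrr /=; apply: eq_bigr => x _; rewrite jump_mulCp.
Qed.

Lemma cindexR_mod p q : cindexR p q = cindexR (p %% q) q.
Proof.
have [->|q0] := eqVneq q 0; first by rewrite modp0.
rewrite modpE cindexRZ /cindexR big_distrr /=; apply: eq_bigr => x _.
rewrite jump_mod; congr (_ * _); rewrite -sgzX.
by rewrite -[in LHS](invrK (_ ^+ _)) !sgz_def invr_eq0 invr_lt0.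
Qed.

Lemma cindexR_swap p q : cindexR q p = crossR (p * q) - cindexR p q.
Proof.
rewrite cindexR_rec; congr (_ + _); rewrite /next_mod cindexRZ sgzN mulNr.
by congr (- _); rewrite [RHS]/cindexR /cindexR big_distrr /=; apply: eq_bigr => x _;
  rewrite [RHS]jump_mod sgzX.
Qed.

Lemma ccount_weakE p sq :
  (0 < ccount_weak p sq) =
  (0 < \sum_(x <- rootsR p) (\prod_(q <- sq) (sgz q.[x] == 1)%:R : int)).
Proof.
rewrite -constraints1P -pmulrn ltr0n -(@ltr0n int) /constraints natr_sum.
congr (_ < _); apply: eq_bigr => x _; rewrite natr_prod [RHS](big_nth 0) big_mkord.
by apply: eq_bigr => i _; rewrite nth_nseq ltn_ord.
Qed.

End CindexField.

Section SignDetermined.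
Import Pdiv.Ring Pdiv.ComRing.
Variables (E1 E2 : rcfType) (C : idomainType).
Implicit Types (p q r : {poly C}) (Q : seq C).
Implicit Types (a : {rmorphism C -> E1}) (b : {rmorphism C -> E2}).

Definition same_signs Q a b := {in Q, forall c, sgz (a c) = sgz (b c)}.

Definition sign_determined (X : Type) (F1 : {rmorphism C -> E1} -> X)
    (F2 : {rmorphism C -> E2} -> X) : Prop :=
  exists Q, forall a b, same_signs Q a b -> F1 a = F2 b.

Lemma same_signs_cat Q1 Q2 a b :
  same_signs (Q1 ++ Q2) a b <-> same_signs Q1 a b /\ same_signs Q2 a b.
Proof.
split=> [H|[H1 H2] c]; first by split=> c cQ; apply: H; rewrite mem_cat cQ ?orbT.
by rewrite mem_cat => /orP[/H1|/H2].
Qed.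


Lemma sign_determined_map (X Y : Type) (f : X -> Y) F1 F2 :
  sign_determined F1 F2 -> sign_determined (fun a => f (F1 a)) (fun b => f (F2 b)).
Proof. by case=> Q HQ; exists Q => a b /HQ ->. Qed.

Lemma sign_determined_map2 (X Y Z : Type) (f : X -> Y -> Z) F1 F2 G1 G2 :
  sign_determined F1 F2 -> sign_determined G1 G2 ->
  sign_determined (fun a => f (F1 a) (G1 a)) (fun b => f (F2 b) (G2 b)).
Proof.
case=> Q HQ [Q' HQ']; exists (Q ++ Q') => a b.
by move=> /same_signs_cat[/HQ -> /HQ' ->].
Qed.

Lemma sign_determined_eq (X : Type) F1 F2 F1' F2' :
  F1 =1 F1' -> F2 =1 F2' ->
  @sign_determined X F1' F2' -> sign_determined F1 F2.
Proof. by move=> e1 e2 [Q HQ]; exists Q => a b /HQ; rewrite e1 e2. Qed.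

Lemma map_take_lead (D : nzRingType) (f : {rmorphism C -> D}) p :
  f (lead_coef p) = 0 -> map_poly f p = map_poly f (take_poly (size p).-1 p).
Proof.
move=> f0; apply/polyP => i; rewrite !coef_map coef_take_poly /=.
case: ltnP => // le_pi; rewrite rmorph0.
move: le_pi; rewrite leq_eqVlt => /orP[/eqP<- //|].
by case: (posnP (size p)) => [p0 _|p_gt0]; [|rewrite prednK // => ?];
  rewrite nth_default ?p0 ?rmorph0.
Qed.

(* Dropping leading coefficients that vanish under the specialisations, one
   may assume that the leading coefficient survives. *)
Lemma sign_determined_trunc (X : Type) (F1 : {rmorphism C -> E1} -> {poly E1} -> X)
    (F2 : {rmorphism C -> E2} -> {poly E2} -> X) p :
  (forall a b, F1 a 0 = F2 b 0) ->
  (forall q, (size q <= size p)%N -> exists Q, forall a b, same_signs Q a b ->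
     a (lead_coef q) != 0 -> b (lead_coef q) != 0 ->
     F1 a (map_poly a q) = F2 b (map_poly b q)) ->
  sign_determined (fun a => F1 a (map_poly a p)) (fun b => F2 b (map_poly b p)).
Proof.
move=> F0; have [m] := ubnP (size p); elim: m p => // m IHm p lt_pm H.
have [->|p0] := eqVneq p 0; first by exists [::] => a b _; rewrite !map_poly0.
have p_gt0 : (0 < size p)%N by rewrite size_poly_gt0.
have [Q HQ] := H p (leqnn _).
have sz : (size (take_poly (size p).-1 p) < size p)%N.
  by rewrite (leq_ltn_trans (size_take_poly _ _)) // prednK.
have [||Q' HQ'] := IHm (take_poly (size p).-1 p).
- exact: leq_trans sz _.
- by move=> q le_q; apply: H; apply: leq_trans le_q (ltnW sz).
exists (lead_coef p :: Q ++ Q') => a b; rewrite -cat1s.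
move=> /same_signs_cat[sL /same_signs_cat[sQ sQ']].
have {}sL : sgz (a (lead_coef p)) = sgz (b (lead_coef p)) by apply: sL; rewrite mem_seq1.
have e : (a (lead_coef p) == 0) = (b (lead_coef p) == 0).
  by rewrite -sgz_eq0 sL sgz_eq0.
have [a0|a0] := eqVneq (a (lead_coef p)) 0.
  rewrite (map_take_lead a0) (@map_take_lead _ b); first exact: HQ'.
  by apply/eqP; rewrite -e a0.
by apply: HQ; rewrite // -e.
Qed.

Lemma sign_determined_size p :
  sign_determined (fun a => size (map_poly a p)) (fun b => size (map_poly b p)).
Proof.
apply: (@sign_determined_trunc _ (fun=> size) (fun=> size)).
  by move=> a b; rewrite !size_poly0.
by move=> q _; exists [::] => a b _ a0 b0; rewrite !size_map_poly_id0.
Qed.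

Lemma sign_determined_lead p :
  sign_determined (fun a => sgz (lead_coef (map_poly a p)))
             (fun b => sgz (lead_coef (map_poly b p))).
Proof.
apply: (@sign_determined_trunc _ (fun _ u => sgz (lead_coef u)) (fun _ u => sgz (lead_coef u))).
  by move=> a b; rewrite !lead_coef0 !sgz0.
move=> q _; exists [:: lead_coef q] => a b s a0 b0.
by rewrite !lead_coef_map_id0 ?rmorph0 ?s ?mem_seq1.
Qed.

Lemma sign_determined_minfty p :
  sign_determined
    (fun a => sgz ((-1) ^+ (size (map_poly a p)).-1 * lead_coef (map_poly a p)))
    (fun b => sgz ((-1) ^+ (size (map_poly b p)).-1 * lead_coef (map_poly b p))).
Proof.
have := sign_determined_map2 (fun n s => (-1) ^+ n.-1 * s)
  (sign_determined_size p) (sign_determined_lead p).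
by apply: sign_determined_eq => a; rewrite sgzM sgzX sgzN1.
Qed.

Lemma sign_determined_crossR p :
  sign_determined (fun a => crossR (map_poly a p)) (fun b => crossR (map_poly b p)).
Proof.
have := sign_determined_map2 (fun s t : int => t * (s * t < 0)%R)
  (sign_determined_minfty p) (sign_determined_lead p).
apply: sign_determined_eq => a; rewrite /crossR /variation /sgp_minfty /sgp_pinfty;
by rewrite sgz_sgr -[in RHS]sgzM sgz_lt0 -sgrM sgr_lt0.
Qed.

Lemma map_pseudo_rem (D : fieldType) (f : {rmorphism C -> D}) p q :
  f (lead_coef q) != 0 ->
  (f (lead_coef q) ^+ rscalp p q *: map_poly f p) %% map_poly f q =
  map_poly f (rmodp p q).
Proof.
move=> fq; have q0 : q != 0 by apply: contraNneq fq => ->; rewrite lead_coef0 rmorph0.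
rewrite -rmorphXn -map_polyZ rdivp_eq rmorphD rmorphM /=.
rewrite modp_addl_mul_small // (leq_ltn_trans (size_poly _ _)) //.
by rewrite size_map_poly_id0 // ltn_rmodp.
Qed.

Lemma sign_determined_cindexR p q :
  sign_determined (fun a => cindexR (map_poly a q) (map_poly a p))
             (fun b => cindexR (map_poly b q) (map_poly b p)).
Proof.
have [m] := ubnP (size q); elim: m p q => // m IHm p q lt_qm.
apply: (@sign_determined_trunc _ (fun a u => cindexR u (map_poly a p))
  (fun b u => cindexR u (map_poly b p))) => [a b|q' le_q].
  by rewrite !cindexR0p.
have [q0|q0] := eqVneq q' 0.
  by exists [::] => a b _; rewrite q0 lead_coef0 rmorph0 eqxx.
have [|Q HQ] := IHm q' (rmodp p q').
  by rewrite (leq_trans (ltn_rmodpN0 _ _)) // -ltnS (leq_ltn_trans le_q).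
have [Q' HQ'] := sign_determined_crossR (p * q').
exists (lead_coef q' :: Q ++ Q') => a b; rewrite -cat1s.
move=> /same_signs_cat[sL /same_signs_cat[sQ sQ']] a0 b0.
have {}sL : sgz (a (lead_coef q')) = sgz (b (lead_coef q')) by apply: sL; rewrite mem_seq1.
rewrite (cindexR_swap (map_poly a p)) (cindexR_swap (map_poly b p)) -!rmorphM /= (HQ' _ _ sQ'); congr (_ - _).
have key (E : rcfType) (c : E) k u v :
    c != 0 -> cindexR u v = sgz c ^+ k * cindexR ((c ^+ k *: u) %% v) v.
  move=> c0; rewrite -cindexR_mod cindexRZ sgzX mulrA -exprMn.
  by rewrite mulz_sg c0 expr1n mul1r.
rewrite (key _ _ (rscalp p q') _ _ a0) (key _ _ (rscalp p q') _ _ b0).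
by rewrite !map_pseudo_rem // sL (HQ _ _ sQ).
Qed.

Lemma sign_determined_taq p q :
  sign_determined (fun a => taq (rootsR (map_poly a p)) (map_poly a q))
             (fun b => taq (rootsR (map_poly b p)) (map_poly b q)).
Proof.
have := sign_determined_cindexR p (p^`() * q).
by apply: sign_determined_eq => a;
  rewrite taq_taqR /taqR changes_mods_cindex rmorphM /= deriv_map.
Qed.

(* The indicator of [s = 1] is [(s + s ^+ 2) / 2] for a sign [s]. *)
Lemma sign_determined_count p w (sq : seq {poly C}) :
  sign_determined
    (fun a => \sum_(x <- rootsR (map_poly a p)) sgz (map_poly a w).[x] *
        \prod_(q <- sq) (sgz (map_poly a q).[x] == 1)%:R)
    (fun b => \sum_(x <- rootsR (map_poly b p)) sgz (map_poly b w).[x] *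
        \prod_(q <- sq) (sgz (map_poly b q).[x] == 1)%:R).
Proof.
elim: sq w => [|q sq IH] w.
  have := sign_determined_taq p w; apply: sign_determined_eq => a;
  by apply: eq_bigr => x _; rewrite big_nil mulr1.
have [Q HQ] := sign_determined_map2 (fun s t : int => s + t) (IH (w * q)) (IH (w * q ^+ 2)).
have key (E : rcfType) (f : {rmorphism C -> E}) :
    2 * (\sum_(x <- rootsR (map_poly f p)) sgz (map_poly f w).[x] *
        \prod_(u <- q :: sq) (sgz (map_poly f u).[x] == 1)%:R) =
    \sum_(x <- rootsR (map_poly f p)) sgz (map_poly f (w * q)).[x] *
        \prod_(u <- sq) (sgz (map_poly f u).[x] == 1)%:R +
    \sum_(x <- rootsR (map_poly f p)) sgz (map_poly f (w * q ^+ 2)).[x] *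
        \prod_(u <- sq) (sgz (map_poly f u).[x] == 1)%:R :> int.
  rewrite -big_split /= mulr_sumr; apply: eq_bigr => x _.
  rewrite big_cons expr2 !rmorphM /= !hornerM !sgzM -mulrDl !mulrA; congr (_ * _).
  by case: (sgzP (map_poly f q).[x]) => _ /=; ring.
exists Q => a b s; apply: (@mulfI _ 2) => //.
by rewrite !key; apply: HQ.
Qed.

Lemma sign_determined_ccount_weak p (sq : seq {poly C}) :
  sign_determined
    (fun a => 0 < ccount_weak (map_poly a p) (map (map_poly a) sq))
    (fun b => 0 < ccount_weak (map_poly b p) (map (map_poly b) sq)).
Proof.
have := sign_determined_map (fun s => 0 < s) (sign_determined_count p 1 sq).
apply: sign_determined_eq => a; rewrite ccount_weakE; congr (_ < _);
by apply: eq_bigr => x _; rewrite rmorph1 hornerC sgz1 mul1r big_map.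
Qed.

Lemma sign_determined_all (T : Type) (F1 : T -> {rmorphism C -> E1} -> bool)
    (F2 : T -> {rmorphism C -> E2} -> bool) (ts : seq T) :
  (forall t, sign_determined (F1 t) (F2 t)) ->
  sign_determined (fun a => all (F1^~ a) ts) (fun b => all (F2^~ b) ts).
Proof.
move=> H; elim: ts => [|t ts IH]; first by exists [::].
exact: (sign_determined_map2 andb (H t) IH).
Qed.

Lemma sign_determined_ccount_gt0 p (sq : seq {poly C}) :
  sign_determined
    (fun a => ccount_gt0 [:: map_poly a p] (map (map_poly a) sq))
    (fun b => ccount_gt0 [:: map_poly b p] (map (map_poly b) sq)).
Proof.
have d0 := sign_determined_map (fun m => m != 0%N) (sign_determined_size p).
have d1 := sign_determined_all sq
  (fun q => sign_determined_map (fun s => 0 < s) (sign_determined_lead q)).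
have d2 := sign_determined_all sq
  (fun q => sign_determined_map (fun s => 0 < s) (sign_determined_minfty q)).
have d3 := sign_determined_ccount_weak p sq.
have d4 := sign_determined_ccount_weak (\prod_(q <- sq) q)^`() sq.
have := sign_determined_map2 (fun u v => if u.1 then u.2 else v)
  (sign_determined_map2 pair d0 d3)
  (sign_determined_map2 orb d1 (sign_determined_map2 orb d2 d4)).
apply: sign_determined_eq => a; rewrite /ccount_gt0 big_cons big_nil rgcdp0 /= size_poly_eq0;
rewrite /bounding_poly !big_map !big_all -(rmorph_prod (map_poly a)) deriv_map;
by case: ifP => // _; congr [|| _, _ | _]; apply: eq_all => q /=; rewrite sgz_gt0.
Qed.

Lemma sign_transfer_ex p (sq : seq {poly C}) : exists Q, forall a b, same_signs Q a b ->
  (exists2 x, (map_poly a p).[x] = 0 & forall q, q \in sq -> 0 < (map_poly a q).[x]) ->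
  (exists2 y, (map_poly b p).[y] = 0 & forall q, q \in sq -> 0 < (map_poly b q).[y]).
Proof.
have [Q HQ] := sign_determined_ccount_gt0 p sq.
exists Q => a b /HQ e [x px qx].
have /ccount_gt0P[y] : ccount_gt0 [:: map_poly b p] (map (map_poly b) sq).
  rewrite -e; apply/ccount_gt0P; exists x; rewrite !big_all /= px eqxx /=.
  by apply/allP => u /mapP[q qsq ->]; apply: qx.
rewrite !big_all /= andbT => /andP[/eqP py /allP qy]; exists y => // q qsq.
by apply: qy; apply: map_f.
Qed.

Lemma sign_transfer_seq (ts : seq {poly C}) : exists Q, forall a b, same_signs Q a b ->
  forall x, exists y, forall q, q \in ts ->
    sgz (map_poly a q).[x] = sgz (map_poly b q).[y].
Proof.
suff H p (sq : seq {poly C}) : exists Q, forall a b, same_signs Q a b -> forall x,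
    (map_poly a p).[x] = 0 -> (forall q, q \in sq -> 0 < (map_poly a q).[x]) ->
    exists y, [/\ (map_poly b p).[y] = 0,
      forall q, q \in sq -> 0 < (map_poly b q).[y]
      & forall q, q \in ts -> sgz (map_poly a q).[x] = sgz (map_poly b q).[y]].
  have [Q HQ] := H 0 [::]; exists Q => a b s x.
  by have [||y [_ _ Hy]] := HQ a b s x; rewrite ?map_poly0 ?horner0 //; exists y.
elim: ts p sq => [|t ts IH] p sq.
  have [Q HQ] := sign_transfer_ex p sq; exists Q => a b s x px qx.
  by have [|y py qy] := HQ a b s; [exists x|exists y].
have [Q0 H0] := IH (p ^+ 2 + t ^+ 2) sq.
have [Q1 H1] := IH p (t :: sq); have [Q2 H2] := IH p (- t :: sq).
exists (Q0 ++ Q1 ++ Q2) => a b /same_signs_cat[s0 /same_signs_cat[s1 s2]] x px qx.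
case: (sgzP (map_poly a t).[x]) => tx.
- have [|y [py qy ty]] := H0 _ _ s0 x _ qx.
    by rewrite rmorphD !rmorphXn /= hornerD !horner_exp px tx !expr0n addr0.
  move/eqP: py; rewrite rmorphD !rmorphXn /= hornerD !horner_exp.
  rewrite paddr_eq0 ?sqr_ge0 // !sqrf_eq0 => /andP[/eqP py /eqP ty0].
  exists y; split=> // q; rewrite inE => /orP[/eqP->|/ty //].
  by rewrite tx ty0 !sgz0.
- have [|y [py qy ty]] := H1 _ _ s1 x px.
    by move=> q; rewrite inE => /orP[/eqP->|/qx].
  exists y; split=> // [q qs|q]; first by apply: qy; rewrite inE qs orbT.
  rewrite inE => /orP[/eqP->|/ty //].
  by rewrite (gtr0_sgz tx) gtr0_sgz // qy // mem_head.
- have [|y [py qy ty]] := H2 _ _ s2 x px.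
    move=> q; rewrite inE => /orP[/eqP->|/qx //].
    by rewrite rmorphN hornerN oppr_gt0.
  exists y; split=> // [q qs|q]; first by apply: qy; rewrite inE qs orbT.
  rewrite inE => /orP[/eqP->|/ty //].
  have := qy _ (mem_head _ _); rewrite rmorphN hornerN oppr_gt0 => ty0.
  by rewrite !ltr0_sgz.
Qed.

End SignDetermined.

Section MpolyTransfer.

Definition int_eval (D : comNzRingType) m (v : nat -> D) : mpoly m int -> D :=
  mmap intr (fun i : 'I_m => v i).

HB.instance Definition _ (D : comNzRingType) m (v : nat -> D) :=
  GRing.RMorphism.on (@int_eval D m v).

Lemma int_eval_muni (D : comNzRingType) m (v : nat -> D) (p : mpoly m.+1 int) :
  int_eval v p = (map_poly (int_eval v) (muni p)).[v m].
Proof.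
rewrite muniE rmorph_sum horner_sum /= {1}/int_eval /mmap; apply: eq_bigr => c _.
rewrite -(mul_polyC (_ *: _)) -mul_mpolyC polyCM.
rewrite !rmorphM /= !map_polyC map_polyXn /=.
rewrite !hornerM !hornerC horner_exp hornerX.
rewrite /int_eval mmapC mmapX -mulrA /mmap1 big_ord_recr /=; congr (_ * (_ * _)).
by apply: eq_bigr => i _; rewrite mnmE.
Qed.

Lemma int_eval_eq (D : comNzRingType) m (v u : nat -> D) (p : mpoly m int) :
  (forall i, (i < m)%N -> v i = u i) -> int_eval v p = int_eval u p.
Proof.
move=> e; apply: eq_bigr => c _; congr (_ * _).
by apply: mmap1_eq => i; apply: e.
Qed.

(* Tarski's transfer principle, in the form of a finite back-and-forth step. *)
Lemma sign_transfer (E1 E2 : rcfType) r N (ts : seq (mpoly (r + N) int)) :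
  exists Q : seq (mpoly N int), forall (v : nat -> E1) (u : nat -> E2),
    {in Q, forall c, sgz (int_eval v c) = sgz (int_eval u c)} ->
  exists2 u' : nat -> E2, forall i, (i < N)%N -> u' i = u i
    & {in ts, forall t, sgz (int_eval v t) = sgz (int_eval u' t)}.
Proof.
elim: r ts => [|r IH] ts; first by exists ts => v u H; exists u.
have [Q1 H1] := sign_transfer_seq E1 E2 (map (@muni _ _) ts : seq {poly mpoly (r + N) int}).
have [Q HQ] := IH Q1; exists Q => v u /HQ[u1 u1u s1].
have [y Hy] := H1 (int_eval v) (int_eval u1) s1 (v (r + N)%N).
pose u' i := if i == (r + N)%N then y else u1 i.
have e i : (i < r + N)%N -> u' i = u1 i by rewrite /u'; case: ltngtP.
exists u' => [i lt_iN|t tts].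
  by rewrite e ?u1u // (leq_trans lt_iN) // leq_addl.
rewrite !int_eval_muni (Hy (muni t)) ?map_f // {2}/u' eqxx.
by congr (sgz (horner _ _)); apply: eq_map_poly => c; apply: int_eval_eq => i /e.
Qed.

End MpolyTransfer.

(** * Real closed fields from maximal cones *)

Lemma zorn_above (T : Type) (P : set T -> Prop) (C0 : set T) :
  P C0 ->
  (forall F : set (set T), F !=set0 -> F `<=` P -> total_on F subset ->
    P (\bigcup_(X in F) X)) ->
  exists A, [/\ P A, C0 `<=` A & forall B, P B -> A `<=` B -> B `<=` A].
Proof.
move=> P0 Pchain; pose P' A := A = set0 \/ (P A /\ C0 `<=` A).
have [A [P'A maxA]] : exists A, P' A /\ forall B, A `<` B -> ~ P' B.
  apply: Zorn_bigcup => F FP' Ftot.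
  pose F' := F `&` [set X | P X /\ C0 `<=` X].
  have [F'0|nF'] := pselect (F' !=set0); last first.
    left; rewrite -subset0 => x [X FX Xx]; have [X0|PX] := FP' X FX.
      by move: Xx; rewrite X0.
    by case: nF'; exists X.
  right; have -> : \bigcup_(X in F) X = \bigcup_(X in F') X.
    apply/seteqP; split=> x [X FX Xx]; last by exists X => //; case: FX.
    exists X => //; split=> //; have [X0|//] := FP' X FX.
    by move: Xx; rewrite X0.
  split; last by have [X F'X] := F'0 => x C0x; exists X => //; case: F'X => _ [_]; apply.
  apply: Pchain => //; first by move=> X [_ []].
  by move=> X Y [FX _] [FY _]; apply: Ftot.
have {P'A} [PA CA] : P A /\ C0 `<=` A.
  case: P'A => // A0; have [C00|/set0P C0n] := eqVneq C0 set0.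
    by rewrite A0 -C00; split.
  case: (maxA C0); last by right; split.
  by rewrite A0; split=> [|H]; [exact: sub0set | case: C0n => x /H].
exists A; split=> // B PB AB; apply: contrapT => nBA.
by case: (maxA B) => //; right; split=> //; apply: subset_trans AB.
Qed.

Section PolySignChange.
Variable E : realFieldType.

Definition ivt_below (m : nat) : Prop := forall (p : {poly E}) a b, (size p < m)%N ->
  a <= b -> p.[a] <= 0 <= p.[b] -> exists2 x, a <= x <= b & root p x.

Lemma ivt_below_opp m (p : {poly E}) a b : ivt_below m -> (size p < m)%N ->
  a <= b -> p.[b] <= 0 <= p.[a] -> exists2 x, a <= x <= b & root p x.
Proof.
move=> ivt pm ab /andP[pb pa]; have [||x xab] := ivt (- p) a b _ ab.
- by rewrite size_polyN.
- by rewrite !hornerN oppr_le0 pa oppr_ge0.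
by rewrite rootN; exists x.
Qed.

Lemma ivt_below_mul m (p q : {poly E}) a b : ivt_below m -> (size p < m)%N ->
  (size q < m)%N -> a <= b -> (p * q).[a] < 0 < (p * q).[b] ->
  exists2 x, a <= x <= b & root (p * q) x.
Proof.
move=> ivt pm qm ab; rewrite !hornerM => /andP[pqa pqb].
have pa0 : p.[a] != 0 by apply: contraTneq pqa => ->; rewrite mul0r ltxx.
have pb0 : p.[b] != 0 by apply: contraTneq pqb => ->; rewrite mul0r ltxx.
suff [[x xab rx]|[x xab rx]] : (exists2 x, a <= x <= b & root p x) \/
    (exists2 x, a <= x <= b & root q x).
- by exists x; rewrite // rootM rx.
- by exists x; rewrite // rootM rx orbT.
move: pa0 pb0; rewrite !neq_lt => /orP[pa|pa] /orP[pb|pb].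
- right; apply: (ivt_below_opp ivt qm ab); apply/andP; split; apply: ltW.
    by rewrite -(nmulr_rgt0 _ pb).
  by rewrite -(nmulr_rlt0 _ pa).
- by left; apply: (ivt _ _ _ pm ab); rewrite !ltW.
- by left; apply: (ivt_below_opp ivt pm ab); rewrite !ltW.
- right; apply: (ivt _ _ _ qm ab); apply/andP; split; apply: ltW.
    by rewrite -(pmulr_rlt0 _ pa).
  by rewrite -(pmulr_rgt0 _ pb).
Qed.

Implicit Types l : seq (E * {poly E}).

Lemma sum_sqr_horner_eq0 l x :
  (forall u, u \in l -> 0 < u.1) -> (\sum_(u <- l) u.1 *: u.2 ^+ 2).[x] = 0 ->
  forall u, u \in l -> root u.2 x.
Proof.
move=> l0 e u ul; move/eqP: e; rewrite horner_sum big_seq.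
rewrite psumr_eq0 => [/allP /(_ u ul)|v vl].
  rewrite ul /= hornerZ horner_exp mulf_eq0 (gt_eqF (l0 u ul)) /= sqrf_eq0.
  by rewrite rootE.
by rewrite hornerZ horner_exp mulr_ge0 ?sqr_ge0 // ltW ?l0.
Qed.

Lemma sum_sqr_eq0 l :
  (forall u, u \in l -> 0 < u.1) -> \sum_(u <- l) u.1 *: u.2 ^+ 2 = 0 ->
  forall u, u \in l -> u.2 = 0.
Proof.
move=> l0 e u ul; apply/eqP/negPn/negP => u0.
have := @max_poly_roots _ u.2 [seq i%:R | i <- iota 0 (size u.2)] u0.
rewrite size_map size_iota ltnn => H; suff: false by [].
apply: H; first by apply/allP => x _; apply: (sum_sqr_horner_eq0 l0) => //; rewrite e horner0.
by rewrite map_inj_uniq ?iota_uniq // => i j /eqP; rewrite eqr_nat => /eqP.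
Qed.

Section Minimal.
Variables (p : {poly E}) (a b : E).
Hypotheses (ivt : ivt_below (size p)) (ab : a <= b).
Hypotheses (pa : p.[a] < 0) (pb : 0 < p.[b]).
Hypothesis noroot : forall x, a <= x <= b -> ~~ root p x.

Let p_neq0 : p != 0.
Proof. by apply: contraTneq pa => ->; rewrite horner0 ltxx. Qed.

Let size_p_gt1 : (1 < size p)%N.
Proof.
rewrite ltnNge; apply/negP => /size1_polyC e.
by move: pa pb; rewrite e !hornerC => /ltW; rewrite leNgt => /negPf->.
Qed.

Lemma sum_sqr_dvd_small l h :
  (forall u, u \in l -> 0 < u.1) -> (forall u, u \in l -> (size u.2 < size p)%N) ->
  \sum_(u <- l) u.1 *: u.2 ^+ 2 = p * h ->
  forall u, u \in l -> u.2 = 0.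
Proof.
have [k] := ubnP (size h); elim: k h l => // k IH h l lt_hk l0 lp e.
have [h0|h0] := eqVneq h 0; first by apply: sum_sqr_eq0 => //; rewrite e h0 mulr0.
have lt_hp : (size h < size p)%N.
  have : (size (p * h)%R <= ((size p).-2 * 2).+1)%N.
    rewrite -e (leq_trans (size_sum _ _ _)) //; apply/bigmax_leqP_seq => u ul _.
    rewrite (leq_trans (size_scale_leq _ _)) // (leq_trans (size_poly_exp_leq _ _)) //.
    rewrite ltnS leq_mul2r /=; have := lp u ul.
    by case: (size p) => // k'; rewrite ltnS => /= sz; rewrite -!subn1 leq_sub2r.
  rewrite size_mul //; move: size_p_gt1; case: (size p) => // -[] // k' _ /=.
  by case: (size h) => [|sh] //; lia.
have S0 x : 0 <= (p * h).[x].
  rewrite -e horner_sum big_seq sumr_ge0 // => u ul.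
  by rewrite hornerZ horner_exp mulr_ge0 ?sqr_ge0 // ltW ?l0.
have [|c cab hc] := ivt lt_hp ab.
  have := S0 a; have := S0 b; rewrite !hornerM.
  by rewrite (nmulr_rge0 _ pa) (pmulr_rge0 _ pb) => -> ->.
have pc : p.[c] != 0 by have := noroot cab; rewrite rootE.
have uc u : u \in l -> root u.2 c.
  apply: (sum_sqr_horner_eq0 l0); rewrite e hornerM.
  by rewrite (rootP hc) mulr0.
pose d := 'X - c%:P; have d0 : d != 0 by rewrite polyXsubC_eq0.
have dE q : root q c -> q = (q %/ d) * d by rewrite -dvdp_XsubCl => /divpK.
pose l' := [seq (u.1, u.2 %/ d) | u <- l].
have e' : (\sum_(u <- l') u.1 *: u.2 ^+ 2) * d = p * (h %/ d).
  apply: (mulIf d0); rewrite -[RHS]mulrA -dE // -e big_map -mulrA -expr2 mulr_suml.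
  rewrite !big_seq; apply: eq_bigr => u ul.
  by rewrite -scalerAl -exprMn -dE ?uc.
have h1 : root (h %/ d) c.
  have := congr1 (fun q => q.[c]) e'; rewrite /= !hornerM hornerXsubC subrr mulr0.
  by move/esym/eqP; rewrite mulf_eq0 (negPf pc).
have e2 : \sum_(u <- l') u.1 *: u.2 ^+ 2 = p * ((h %/ d) %/ d).
  by apply: (mulIf d0); rewrite -mulrA -dE.
move=> u ul; have szd (q : {poly E}) : q != 0 -> (size (q %/ d)%R < size q)%N.
  by move=> q0; rewrite size_divp // size_XsubC /= ltn_subrL size_poly_gt0 q0.
suff u0 : u.2 %/ d = 0 by rewrite (dE u.2) ?uc // u0 mul0r.
apply: (IH _ l' _ _ _ e2 (u.1, u.2 %/ d)).
- by rewrite (leq_ltn_trans (leq_divp _ _)) // (leq_trans (szd _ h0)).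
- by move=> _ /mapP[v vl ->]; exact: (l0 v vl).
- move=> _ /mapP[v vl ->] /=; apply: leq_ltn_trans (lp v vl).
  by rewrite leq_divp.
- by apply/mapP; exists u.
Qed.

Lemma sum_sqr_dvd l :
  (forall u, u \in l -> 0 < u.1) -> p %| \sum_(u <- l) u.1 *: u.2 ^+ 2 ->
  forall u, u \in l -> p %| u.2.
Proof.
move=> l0 dv u ul.
pose l' := [seq (v.1, v.2 %% p) | v <- l].
suff /dvdpP[h e] : p %| \sum_(v <- l') v.1 *: v.2 ^+ 2.
  apply/eqP/(@sum_sqr_dvd_small l' h _ _ _ (u.1, u.2 %% p)).
  - by move=> _ /mapP[v vl ->]; exact: (l0 v vl).
  - by move=> _ /mapP[v vl ->]; rewrite ltn_modp.
  - by rewrite e mulrC.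
  - by apply/mapP; exists u.
have -> : \sum_(v <- l') v.1 *: v.2 ^+ 2 = \sum_(v <- l) v.1 *: v.2 ^+ 2 -
    (\sum_(v <- l) v.1 *: ((v.2 %/ p) * (v.2 + v.2 %% p))) * p.
  rewrite big_map mulr_suml -sumrB; apply: eq_bigr => v _ /=.
  rewrite -scalerAl -scalerBr; congr (_ *: _).
  by have := divp_eq v.2 p; move: (v.2 %/ p) (v.2 %% p) => q r ->; ring.
by rewrite dvdp_sub // dvdp_mull.
Qed.

End Minimal.
End PolySignChange.

Lemma map_sum_sqr (F K : fieldType) (f : {rmorphism F -> K}) (l : seq (F * {poly F})) x :
  (map_poly f (\sum_(u <- l) u.1 *: u.2 ^+ 2)).[x] =
  \sum_(u <- l) f u.1 * (map_poly f u.2).[x] ^+ 2.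
Proof.
rewrite rmorph_sum horner_sum; apply: eq_bigr => u _ /=.
by rewrite map_polyZ rmorphXn /= hornerZ horner_exp.
Qed.

Section FieldCone.
Variable K : fieldType.

(* Nonnegative elements of an ordered subring [C - C] of [K], where the order
   need not be total. *)
Definition field_cone (C : set K) : Prop :=
  [/\ C 1, forall x y, C x -> C y -> C (x + y),
      forall x y, C x -> C y -> C (x * y),
      forall x, C x -> C (- x) -> x = 0
    & forall x y, C x -> C y -> C ((x - y) ^+ 2)].

Lemma field_cone_chain (F : set (set K)) :
  F !=set0 -> F `<=` field_cone -> total_on F subset ->
  field_cone (\bigcup_(X in F) X).
Proof.
move=> [X0 FX0] FC Ftot.
have two x y : (\bigcup_(X in F) X) x -> (\bigcup_(X in F) X) y ->
    exists X, [/\ F X, X x & X y].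
  move=> [X FX Xx] [Y FY Yy]; case: (Ftot X Y FX FY) => sXY.
    by exists Y; split=> //; apply: sXY.
  by exists X; split=> //; apply: sXY.
split.
- by exists X0 => //; case: (FC _ FX0).
- by move=> x y xF yF; have [X [FX Xx Xy]] := two x y xF yF;
  exists X => //; have [_ H _ _ _] := FC _ FX; apply: H.
- by move=> x y xF yF; have [X [FX Xx Xy]] := two x y xF yF;
  exists X => //; have [_ _ H _ _] := FC _ FX; apply: H.
- by move=> x xF yF; have [X [FX Xx Xy]] := two x (- x) xF yF;
  have [_ _ _ H _] := FC _ FX; apply: H.
- by move=> x y xF yF; have [X [FX Xx Xy]] := two x y xF yF;
  exists X => //; have [_ _ _ _ H] := FC _ FX; apply: H.
Qed.

End FieldCone.

Section MaximalConeIvt.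
Variables (K : closedFieldType) (C : set K) (E : realFieldType) (f : {rmorphism E -> K}).
Hypothesis Cmax : forall D, field_cone D -> C `<=` D -> D `<=` C.
Hypothesis CE : forall x, C x -> exists2 y, 0 <= y & x = f y.

Local Notation phi := (map_poly f).

Lemma root_dvd (p : {poly E}) a b theta (q : {poly E}) :
  ivt_below E (size p) -> a <= b -> p.[a] < 0 -> 0 < p.[b] ->
  (forall x, a <= x <= b -> ~~ root p x) ->
  root (phi p) theta -> root (phi q) theta -> p %| q.
Proof.
move=> ivt ab pa pb noroot rp rq.
have p0 : p != 0 by apply: contraTneq pa => ->; rewrite horner0 ltxx.
pose d := gcdp p q.
have rd : root (phi d) theta by rewrite gcdp_map root_gcd rp rq.
have d0 : d != 0 by rewrite gcdp_eq0 negb_and p0.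
have sd : (1 < size d)%N.
  have := rootP rd; rewrite -(size_map_poly f).
  rewrite ltnNge; apply: contraPN => /size1_polyC e; rewrite e hornerC => c0.
  by move: d0; rewrite -(map_poly_eq0 f) e c0 eqxx.
have [e|ne] := eqVneq (size d) (size p).
  have dp : d %= p by rewrite -dvdp_size_eqp ?dvdp_gcdl // e.
  by rewrite -(eqp_dvdl q dp) dvdp_gcdr.
have sdp : (size d < size p)%N by rewrite ltn_neqAle ne dvdp_leq // dvdp_gcdl.
have pE : p = (p %/ d) * d by rewrite divpK // dvdp_gcdl.
have [||x xab] := @ivt_below_mul _ (size p) (p %/ d) d a b ivt _ sdp ab.
- rewrite size_divp //; move: sd; case: (size d) => // -[|k] // _.
  by rewrite /= ltn_subrL size_poly_gt0 p0.
- by rewrite -pE pa pb.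
by rewrite -pE (negPf (noroot x xab)).
Qed.

Lemma sign_change_root (p : {poly E}) a b :
  ivt_below E (size p) -> a <= b -> p.[a] < 0 -> 0 < p.[b] ->
  exists2 x, a <= x <= b & root p x.
Proof.
move=> ivt ab pa pb; apply: contrapT => nr.
have noroot x : a <= x <= b -> ~~ root p x.
  by move=> xab; apply/negP => rx; apply: nr; exists x.
have p0 : p != 0 by apply: contraTneq pa => ->; rewrite horner0 ltxx.
have /closed_rootP[theta rt] : size (phi p) != 1%N.
  rewrite size_map_poly; apply: contraTneq pb => s1.
  have /size1_polyC e : (size p <= 1)%N by rewrite s1.
  by move: pa; rewrite e !hornerC => /ltW; rewrite leNgt.
pose sq l := \sum_(u <- l : seq (E * {poly E})) f u.1 * (phi u.2).[theta] ^+ 2.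
pose D := [set x | exists2 l : seq (E * {poly E}), all (fun u => 0 < u.1) l & x = sq l].
have DE x : D x -> exists q, x = (phi q).[theta].
  move=> [l _ ->]; exists (\sum_(u <- l) u.1 *: u.2 ^+ 2).
  by rewrite map_sum_sqr.
have D_sq q : D ((phi q).[theta] ^+ 2).
  by exists [:: (1, q)]; rewrite /= ?ltr01 // /sq big_seq1 rmorph1 mul1r.
have D_cone : field_cone D.
  split.
  - by have := D_sq 1; rewrite rmorph1 hornerC expr1n.
  - move=> _ _ [l l0 ->] [l' l0' ->]; exists (l ++ l'); first by rewrite all_cat l0.
    by rewrite /sq big_cat.
  - move=> _ _ [l l0 ->] [l' l0' ->].
    exists [seq (u.1 * v.1, u.2 * v.2) | u <- l, v <- l'].
      apply/allP => _ /allpairsP[[u v] /= [ul vl ->]] /=.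
      by rewrite mulr_gt0 ?(allP l0 u ul) ?(allP l0' v vl).
    rewrite /sq big_distrlr /= big_allpairs_dep /=; apply: eq_bigr => u _.
    by apply: eq_bigr => v _ /=; rewrite !rmorphM /= hornerM exprMn mulrACA.
  - move=> x [l l0 xl] [l' l0' xl'].
    have l0'' u : u \in l ++ l' -> 0 < u.1.
      by rewrite mem_cat => /orP[/(allP l0)|/(allP l0')].
    have dv : p %| \sum_(u <- l ++ l') u.1 *: u.2 ^+ 2.
      apply: (root_dvd ivt ab pa pb noroot rt); rewrite rootE.
      by rewrite map_sum_sqr big_cat /= -/(sq l) -/(sq l') -xl -xl' subrr.
    rewrite xl /sq big_seq big1 // => u ul.
    have /dvdpP[q ->] : p %| u.2.
      apply: (sum_sqr_dvd ivt ab pa pb noroot l0'' dv).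
      by rewrite mem_cat ul.
    by rewrite rmorphM /= hornerM (rootP rt) mulr0 expr0n mulr0.
  - move=> x y /DE[q ->] /DE[r ->].
    by have := D_sq (q - r); rewrite rmorphB hornerD hornerN.
have CDsub : C `<=` D.
  move=> x /CE[y y0 ->]; have [->|yn0] := eqVneq y 0.
    by exists [::]; rewrite /sq ?big_nil ?rmorph0.
  exists [:: (y, 1)]; first by rewrite /= lt_def yn0 y0.
  by rewrite /sq big_seq1 rmorph1 hornerC expr1n mulr1.
have DC := Cmax D_cone CDsub.
have [t tE] : exists t, theta = f t.
  have /CE[y1 _ e1] : C ((theta + 1) ^+ 2).
    by have := DC _ (D_sq ('X + 1)); rewrite rmorphD /= map_polyX rmorph1 hornerD hornerX hornerC.
  have /CE[y2 _ e2] : C ((theta - 1) ^+ 2).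
    by have := DC _ (D_sq ('X - 1)); rewrite rmorphB /= map_polyX rmorph1 hornerD hornerN hornerX hornerC.
  exists ((y1 - y2) / 4%:R); rewrite fmorph_div rmorphB rmorph_nat -e1 -e2.
  have four : (4%:R : K) != 0.
    by rewrite -(rmorph_nat f) fmorph_eq0 pnatr_eq0.
  by field.
have rpt : root p t by move: rt; rewrite tE rootE horner_map fmorph_eq0.
have /factor_theorem[q pE] := rpt.
have tab : ~~ (a <= t <= b) by apply/negP => /noroot; rewrite rpt.
have szq : (size q < size p)%N.
  have q0 : q != 0 by apply: contraNneq p0 => q0; rewrite pE q0 mul0r.
  by rewrite pE size_mul ?polyXsubC_eq0 // size_XsubC addn2.
apply: nr; suff [x xab rx] : exists2 x, a <= x <= b & root q x.
  by exists x; rewrite // pE rootM rx.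
move: pa pb; rewrite pE !hornerM !hornerXsubC.
have [ta|ta] := ltP t a.
  rewrite pmulr_llt0 ?subr_gt0 // pmulr_lgt0 ?subr_gt0 ?(lt_le_trans ta) // => qa qb.
  by apply: ivt => //; rewrite !ltW.
have tb : b < t by rewrite ltNge; apply: contra tab => ->; rewrite ta.
rewrite nmulr_llt0 ?subr_lt0 ?(le_lt_trans ab) // nmulr_lgt0 ?subr_lt0 // => qa qb.
by apply: (ivt_below_opp ivt) => //; rewrite !ltW.
Qed.

End MaximalConeIvt.

Section MaximalCone.
Variables (K : closedFieldType) (C : set K).
Hypothesis HC : field_cone C.
Hypothesis Cmax : forall D, field_cone D -> C `<=` D -> D `<=` C.

Let C1 : C 1. Proof. by case: HC. Qed.
Let CD x y : C x -> C y -> C (x + y). Proof. by case: HC => _ + _ _ _; apply. Qed.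
Let CM x y : C x -> C y -> C (x * y). Proof. by case: HC => _ _ + _ _; apply. Qed.
Let CN x : C x -> C (- x) -> x = 0. Proof. by case: HC => _ _ _ + _; apply. Qed.
Let Csq x y : C x -> C y -> C ((x - y) ^+ 2). Proof. by case: HC => _ _ _ _; apply. Qed.
Let C0 : C 0. Proof. by have := Csq C1 C1; rewrite subrr expr0n. Qed.

Lemma max_cone_div a x : C a -> a != 0 -> C (a * x) -> C x.
Proof.
move=> Ca a0 Cax; pose D := [set x | exists b, [/\ C b, b != 0 & C (b * x)]].
apply: (Cmax (D := D)); last by exists a.
- split.
  + by exists 1; split; rewrite ?oner_neq0 ?mulr1.
  + move=> u y [b [Cb b0 Cbx]] [c [Cc c0 Ccy]]; exists (b * c); split; first exact: CM.
      by rewrite mulf_neq0.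
    by rewrite mulrDr mulrAC -(mulrA b c y); apply: CD; apply: CM.
  + move=> u y [b [Cb b0 Cbx]] [c [Cc c0 Ccy]]; exists (b * c); split; first exact: CM.
      by rewrite mulf_neq0.
    by rewrite mulrACA; apply: CM.
  + move=> u [b [Cb b0 Cbx]] [c [Cc c0 Ccx]].
    have bc0 : b * c != 0 by rewrite mulf_neq0.
    apply: (mulfI bc0); rewrite mulr0; apply: CN.
      by rewrite mulrAC; apply: CM.
    by rewrite -mulrN -mulrA; apply: CM.
  + move=> u y [b [Cb b0 Cbx]] [c [Cc c0 Ccy]]; exists ((b * c) ^+ 2); split.
    * by rewrite expr2; do 2!apply: CM.
    * by rewrite sqrf_eq0 mulf_neq0.
    rewrite -exprMn mulrBr mulrAC -(mulrA b c y).
    by apply: Csq; apply: CM.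
- by move=> y Cy; exists 1; split; rewrite ?oner_neq0 ?mul1r.
Qed.

Lemma max_cone_total x y : C x -> C y -> C (x - y) \/ C (y - x).
Proof.
move=> Cx Cy; have [|nC] := pselect (C (y - x)); [by right|left].
pose z := x - y; pose D := [set u | exists a b, [/\ C a, C b & u = a + b * z]].
have Cz2 : C (z * z) by rewrite -expr2; apply: Csq.
apply: (Cmax (D := D)); last by exists 0, 1; split=> //; rewrite add0r mul1r.
- split.
  + by exists 1, 0; split=> //; rewrite mul0r addr0.
  + move=> _ _ [a [b [Ca Cb ->]]] [c [d [Cc Cd ->]]].
    by exists (a + c), (b + d); split; [exact: CD|exact: CD|ring].
  + move=> _ _ [a [b [Ca Cb ->]]] [c [d [Cc Cd ->]]].
    exists (a * c + b * d * (z * z)), (a * d + b * c); split.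
    * by apply: CD; [exact: CM|apply: CM => //; exact: CM].
    * by apply: CD; apply: CM.
    by ring.
  + move=> u [a [b [Ca Cb ->]]] [c [d [Cc Cd e]]].
    have e0 : (a + c) + (b + d) * z = 0.
      by rewrite mulrDl addrACA -e subrr.
    have [bd0|bd0] := eqVneq (b + d) 0.
      move: e0; rewrite bd0 mul0r addr0 => ac0.
      have a0 : a = 0 by apply: CN => //; have -> : - a = c; [apply/eqP; rewrite eqr_oppLR -addr_eq0 ac0|].
      have b0 : b = 0 by apply: CN => //; have -> : - b = d; [apply/eqP; rewrite eqr_oppLR -addr_eq0 bd0|].
      by rewrite a0 b0 mul0r addr0.
    case: nC; apply: (max_cone_div (a := b + d)) => //; first exact: CD.
    have -> : y - x = - z by rewrite opprB.
    rewrite mulrN; have -> : - ((b + d) * z) = a + c.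
      by apply/eqP; rewrite eqr_oppLR -addr_eq0 addrC e0.
    exact: CD.
  + move=> _ _ [a [b [Ca Cb ->]]] [c [d [Cc Cd ->]]].
    have -> : a + b * z - (c + d * z) = (a + b * x + d * y) - (c + d * x + b * y).
      by rewrite /z; ring.
    exists ((a + b * x + d * y - (c + d * x + b * y)) ^+ 2), 0.
    by split; rewrite ?mul0r ?addr0 //; apply: Csq; do ?apply: CD; do ?apply: CM.
- by move=> u Cu; exists u, 0; split; rewrite ?mul0r ?addr0.
Qed.


Definition cone_pred : {pred K} := fun x => `[< C x \/ C (- x) >].

Lemma cone_predP x : reflect (exists u v, [/\ C u, C v & x = u - v]) (x \in cone_pred).
Proof.
apply: (iffP (asboolP _)) => [[Cx|Cx]|[u [v [Cu Cv ->]]]].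
- by exists x, 0; rewrite subr0.
- by exists 0, (- x); rewrite sub0r opprK.
- by rewrite opprB; apply: max_cone_total.
Qed.

Lemma cone_pred_divring : divring_closed cone_pred.
Proof.
split.
- by apply/cone_predP; exists 1, 0; rewrite subr0.
- move=> x y /cone_predP[u [v [Cu Cv ->]]] /cone_predP[a [b [Ca Cb ->]]].
  by apply/cone_predP; exists (u + b), (v + a); split; [exact: CD|exact: CD|ring].
- move=> x y Ex /asboolP Ey.
  have {Ey} : y^-1 \in cone_pred.
    apply/asboolP; have [y0|y0] := eqVneq y 0; first by rewrite y0 invr0; left.
    case: Ey => Cy; [left|right].
      by apply: (max_cone_div Cy) => //; rewrite mulfV.
    by apply: (max_cone_div Cy); rewrite ?oppr_eq0 // mulrNN mulfV.
  move: Ex => /cone_predP[u [v [Cu Cv ->]]] /cone_predP[a [b [Ca Cb ->]]].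
  apply/cone_predP; exists (u * a + v * b), (v * a + u * b).
  by split; [by apply: CD; apply: CM|by apply: CD; apply: CM|ring].
Qed.

HB.instance Definition _ := GRing.isDivringClosed.Build K cone_pred cone_pred_divring.

Record cone_field := ConeField { cone_val :> K; _ : cone_val \in cone_pred }.
HB.instance Definition _ := [isSub for cone_val].
HB.instance Definition _ := [Choice of cone_field by <:].
HB.instance Definition _ := [SubChoice_isSubIntegralDomain of cone_field by <:].
HB.instance Definition _ := [SubIntegralDomain_isSubField of cone_field by <:].

Definition cone_le (x y : cone_field) : bool := `[< C (val y - val x) >].

Definition cone_norm (x : cone_field) : cone_field := if cone_le 0 x then x else - x.

Lemma cone_le0P (x : cone_field) : reflect (C (val x)) (cone_le 0 x).
Proof. by apply: (iffP (asboolP _)); rewrite subr0. Qed.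

Lemma cone_le0_add x y : cone_le 0 x -> cone_le 0 y -> cone_le 0 (x + y).
Proof. by move=> /cone_le0P Cx /cone_le0P Cy; apply/cone_le0P; apply: CD. Qed.

Lemma cone_le0_mul x y : cone_le 0 x -> cone_le 0 y -> cone_le 0 (x * y).
Proof. by move=> /cone_le0P Cx /cone_le0P Cy; apply/cone_le0P; apply: CM. Qed.

Lemma cone_le0_anti x : cone_le 0 x -> cone_le x 0 -> x = 0.
Proof.
by move=> /cone_le0P Cx /asboolP; rewrite /= sub0r => Cx'; apply: val_inj; apply: CN.
Qed.

Lemma cone_sub_ge0 x y : cone_le 0 (y - x) = cone_le x y.
Proof. by rewrite /cone_le subr0. Qed.

Lemma cone_le0_total x : cone_le 0 x || cone_le x 0.
Proof.
by apply/orP; case: x => x Ex; rewrite /cone_le /= subr0 sub0r;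
  case/asboolP: (Ex); [left|right]; apply/asboolP.
Qed.

Lemma cone_normN x : cone_norm (- x) = cone_norm x.
Proof.
have le0N y : cone_le 0 (- y) = cone_le y 0 by rewrite /cone_le subr0 sub0r.
rewrite /cone_norm le0N opprK; case: ifP => x0; case: ifP => x0' //.
  by rewrite (cone_le0_anti x0' x0) oppr0.
by have := cone_le0_total x; rewrite x0 x0'.
Qed.

Lemma cone_ge0_norm x : cone_le 0 x -> cone_norm x = x.
Proof. by rewrite /cone_norm => ->. Qed.

HB.instance Definition _ := Num.IntegralDomain_isLeReal.Build cone_field
  cone_le0_add cone_le0_mul cone_le0_anti cone_sub_ge0 cone_le0_total
  cone_normN cone_ge0_norm (fun _ _ => erefl).


Lemma cone_ge0P (x : cone_field) : reflect (C (val x)) (0 <= x).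
Proof. exact: cone_le0P. Qed.

Lemma cone_val_surj x : C x -> exists2 y : cone_field, 0 <= y & x = val y.
Proof.
move=> Cx; have xE : x \in cone_pred by apply/asboolP; left.
by exists (ConeField xE) => //; apply/cone_ge0P.
Qed.

Lemma cone_field_rcf : Num.real_closed_axiom cone_field.
Proof.
suff H m : ivt_below cone_field m by move=> p a b; apply: (H (size p).+1).
elim: m => [|m IH] p a b //; rewrite ltnS => pm ab /andP[pa pb].
have [pa0|pa0] := eqVneq p.[a] 0; first by exists a; rewrite ?lexx // rootE pa0.
have [pb0|pb0] := eqVneq p.[b] 0; first by exists b; rewrite ?lexx ?ab // rootE pb0.
apply: (@sign_change_root K C cone_field \val Cmax cone_val_surj p a b) => //.
- by move=> q c d qp; apply: IH; apply: leq_trans pm.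
- by rewrite lt_neqAle pa0.
- by rewrite lt_def pb0.
Qed.

HB.instance Definition _ := Num.RealField_isClosed.Build cone_field cone_field_rcf.

Lemma maximal_cone_rcf : exists (F : rcfType) (f : {rmorphism F -> K}),
  forall x, C x <-> exists2 y, 0 <= y & x = f y.
Proof.
exists cone_field, (val : cone_field -> K) => x; split=> [|[y y0 ->]].
  exact: cone_val_surj.
exact/cone_ge0P.
Qed.

End MaximalCone.

(** * Prime cones *)

Section RingCone.
Variable A : comNzRingType.
Implicit Types (T P : set A).

Definition preordering T : Prop :=
  [/\ forall x, T (x ^+ 2), forall x y, T x -> T y -> T (x + y),
      forall x y, T x -> T y -> T (x * y) & ~ T (- 1)].

Definition prime_cone P : Prop :=
  [/\ forall x y, P x -> P y -> P (x + y), forall x y, P x -> P y -> P (x * y),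
      forall x, P x \/ P (- x), ~ P (- 1)
    & forall x y, P (x * y) -> P (- (x * y)) ->
        (P x /\ P (- x)) \/ (P y /\ P (- y))].

Lemma preordering_chain (F : set (set A)) :
  F !=set0 -> F `<=` preordering -> total_on F subset ->
  preordering (\bigcup_(X in F) X).
Proof.
move=> [X0 FX0] FC Ftot.
have two x y : (\bigcup_(X in F) X) x -> (\bigcup_(X in F) X) y ->
    exists X, [/\ F X, X x & X y].
  move=> [X FX Xx] [Y FY Yy]; case: (Ftot X Y FX FY) => sXY.
    by exists Y; split=> //; apply: sXY.
  by exists X; split=> //; apply: sXY.
split.
- by move=> x; exists X0 => //; case: (FC _ FX0).
- by move=> x y xF yF; have [X [FX Xx Xy]] := two x y xF yF;
  exists X => //; have [_ H _ _] := FC _ FX; apply: H.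
- by move=> x y xF yF; have [X [FX Xx Xy]] := two x y xF yF;
  exists X => //; have [_ _ H _] := FC _ FX; apply: H.
- by move=> [X FX X1]; have [_ _ _] := FC _ FX; apply.
Qed.

Lemma preordering_prime_cone T : preordering T -> exists2 P, prime_cone P & T `<=` P.
Proof.
move=> HT; have [P [[Psq PD PM P1] TP Pmax]] := zorn_above HT preordering_chain.
have P0 : P 0 by have := Psq 0; rewrite expr0n.
have one : P 1 by have := Psq 1; rewrite expr1n.
have neg x : ~ P x -> exists a b, [/\ P a, P b & - 1 = a + x * b].
  move=> nPx; apply: contrapT => nex.
  pose D := [set u | exists a b, [/\ P a, P b & u = a + x * b]].
  have Dpre : preordering D.
    split.
    - by move=> u; exists (u ^+ 2), 0; split=> //; rewrite mulr0 addr0.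
    - move=> _ _ [a [b [Pa Pb ->]]] [c [d [Pc Pd ->]]].
      by exists (a + c), (b + d); split; [exact: PD|exact: PD|ring].
    - move=> _ _ [a [b [Pa Pb ->]]] [c [d [Pc Pd ->]]].
      exists (a * c + x ^+ 2 * (b * d)), (a * d + b * c); split; last by ring.
        exact: PD (PM _ _ Pa Pc) (PM _ _ (Psq x) (PM _ _ Pb Pd)).
      exact: PD (PM _ _ Pa Pd) (PM _ _ Pb Pc).
    - exact: nex.
  case: nPx; apply: (Pmax D Dpre).
    by move=> u Pu; exists u, 0; split=> //; rewrite mulr0 addr0.
  by exists 0, 1; split=> //; rewrite mulr1 add0r.
have total x : P x \/ P (- x).
  have [|/neg[a [b [Pa Pb e1]]]] := pselect (P x); [by left|].
  have [|/neg[c [d [Pc Pd e2]]]] := pselect (P (- x)); [by right|].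
  case: P1; have -> : - 1 = x ^+ 2 * (b * d) + (a + c + a * c).
    have e : (x * b) * (- x * d) = (- 1 - a) * (- 1 - c).
      have -> : x * b = - 1 - a by rewrite e1; ring.
      by have -> : - x * d = - 1 - c by rewrite e2; ring.
    have -> : x ^+ 2 * (b * d) = - ((x * b) * (- x * d)) by ring.
    by rewrite e; ring.
  exact: PD (PM _ _ (Psq x) (PM _ _ Pb Pd)) (PD _ _ (PD _ _ Pa Pc) (PM _ _ Pa Pc)).
exists P => //; split=> // x y Pxy Pxy'.
have supp z z' : P (z * z') -> P (- (z * z')) -> P z \/ P z'.
  move=> Pz Pz'; have [|/neg[a [b [Pa Pb e1]]]] := pselect (P z); [by left|].
  have [|/neg[c [d [Pc Pd e2]]]] := pselect (P z'); [by right|].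
  case: P1; have -> : - 1 = (- (z * z')) * (b * d) + (a + c + a * c).
    have e : (z * b) * (z' * d) = (- 1 - a) * (- 1 - c).
      have -> : z * b = - 1 - a by rewrite e1; ring.
      by have -> : z' * d = - 1 - c by rewrite e2; ring.
    have -> : (- (z * z')) * (b * d) = - ((z * b) * (z' * d)) by ring.
    by rewrite e; ring.
  exact: PD (PM _ _ Pz' (PM _ _ Pb Pd)) (PD _ _ (PD _ _ Pa Pc) (PM _ _ Pa Pc)).
have h1 := supp x y Pxy Pxy'.
have h2 : P (- x) \/ P (- y) by apply: supp; rewrite mulrNN.
have h3 : P x \/ P (- y) by apply: supp; rewrite mulrN ?opprK.
have h4 : P (- x) \/ P y by apply: supp; rewrite mulNr ?opprK.
by tauto.
Qed.

End RingCone.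

Lemma prime_cone_preim (A B : comNzRingType) (f : {rmorphism A -> B}) (P : set B) :
  prime_cone P -> prime_cone [set x | P (f x)].
Proof.
move=> [PD PM Pt P1 Pp]; split=> /=.
- by move=> x y; rewrite rmorphD; apply: PD.
- by move=> x y; rewrite rmorphM; apply: PM.
- by move=> x; rewrite rmorphN.
- by rewrite rmorphN1.
- by move=> x y; rewrite !rmorphN rmorphM; apply: Pp.
Qed.

Lemma injective_pcan (T S : Type) (h : T -> S) :
  injective h -> exists g : S -> option T, pcancel h g.
Proof.
move=> hi; exists (fun s => if pselect (exists x, h x = s) is left e
  then Some (projT1 (cid e)) else None) => x.
case: pselect => [e|[]]; last by exists x.
by congr Some; apply: hi; case: (cid e).
Qed.

Section ResidueField.
Variables (A : comNzRingType) (S : countType) (h : A -> S).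
Hypothesis h_inj : injective h.
Variable I : A -> bool.
Hypothesis I_ideal : idealr_closed I.
Hypothesis I_prime : prime_idealr_closed I.

Lemma prime_ideal_closed_field : exists (K : closedFieldType) (f : {rmorphism A -> K}),
  forall x, (f x == 0) = I x.
Proof.
pose IaM := GRing.isZmodClosed.Build _ I (idealr_closedB I_ideal).
pose IpM := isProperIdeal.Build _ I (idealr_closed_nontrivial I_ideal).
pose IqM := isPrimeIdealrClosed.Build _ I I_prime.
pose J : prime_idealr _ := HB.pack I IaM IpM IqM.
pose Q : comNzRingType := {ideal_quot J}.
pose inv (x : Q) : Q := if pselect (exists y, y * x = 1) is left e then projT1 (cid e) else x.
pose unit (x : Q) : bool := `[< exists y, y * x = 1 >].
have mulV : {in unit, left_inverse 1 inv *%R}.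
  move=> x /asboolP e; rewrite /inv; case: pselect => // e'.
  by case: (cid e').
have unitP (x y : Q) : y * x = 1 -> unit x by move=> e; apply/asboolP; exists y.
have inv_out : {in [predC unit], inv =1 id}.
  by move=> x /asboolP nu; rewrite /inv; case: pselect.
pose Qu := GRing.ComNzRing_hasMulInverse.Build Q mulV unitP inv_out.
pose Qun : comUnitRingType := HB.pack Q Qu.
have Qint (x y : Qun) : x * y = 0 -> (x == 0) || (y == 0).
  exact: (@Quotient.rquot_IdomainAxiom _ J).
pose Qi := GRing.ComUnitRing_isIntegral.Build Qun Qint.
pose D : idomainType := HB.pack Q Qun Qi.
pose toD : {rmorphism A -> D} := \pi_Q%qT.
have toD0 x : (toD x == 0) = I x.
  by rewrite piE Quotient.equivE subr0.
pose k (x : {fraction D}) : S * S :=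
  let u := repr x : {ratio D} in
  (h (repr ((val u).1 : Q)), h (repr ((val u).2 : Q))).
have k_inj : injective k.
  move=> x y [/h_inj/(can_inj reprK) e1 /h_inj/(can_inj reprK) e2].
  apply: (can_inj (@reprK _ _)); apply: val_inj.
  by rewrite [LHS]surjective_pairing [RHS]surjective_pairing; congr pair.
have [g kg] := injective_pcan k_inj.
pose Fc := isCountable.Build {fraction D} (pcan_pickleK kg).
pose F : countFieldType := HB.pack {fraction D} Fc.
have [K [FK _]] := countable_algebraic_closure F.
exists K, (FK \o (@FracField.tofrac D : D -> F) \o toD) => x /=.
by rewrite fmorph_eq0 tofrac_eq0 toD0.
Qed.

End ResidueField.

Lemma prime_cone_rcf (A : comNzRingType) (S : countType) (h : A -> S) (P : set A) :
  injective h -> prime_cone P ->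
  exists (F : rcfType) (f : {rmorphism A -> F}), forall x, P x <-> 0 <= f x.
Proof.
move=> h_inj [PD PM Pt P1 Pp].
have Psq x : P (x ^+ 2).
  by rewrite expr2; case: (Pt x) => Px; [|rewrite -mulrNN]; exact: PM.
have one : P 1 by have := Psq 1; rewrite expr1n.
have P0 : P 0 by have := Psq 0; rewrite expr0n.
pose I x := `[< P x /\ P (- x) >].
have Iid : idealr_closed I.
  split.
  - by apply/asboolP; rewrite oppr0.
  - by apply/asboolP => -[].
  - move=> a u v /asboolP[Pu Pu'] /asboolP[Pv Pv']; apply/asboolP.
    rewrite opprD; split; apply: PD => //; case: (Pt a) => Pa.
    + exact: PM.
    + by rewrite -mulrNN; apply: PM.
    + by rewrite -mulrN; apply: PM.
    + by rewrite -mulNr; apply: PM.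
have Ipr : prime_idealr_closed I.
  move=> u v /asboolP[Puv Puv']; apply/orP.
  by case: (Pp _ _ Puv Puv') => H; [left|right]; apply/asboolP.
have [K [f fI]] := prime_ideal_closed_field h_inj Iid Ipr.
have fP x : f x = 0 -> P x /\ P (- x) by move/eqP; rewrite fI => /asboolP.
pose C0 : set K := [set y | exists2 x, P x & y = f x].
have C0_cone : field_cone C0.
  split.
  - by exists 1; rewrite ?rmorph1.
  - move=> _ _ [x Px ->] [y Py ->]; exists (x + y); rewrite ?rmorphD //; exact: PD.
  - move=> _ _ [x Px ->] [y Py ->]; exists (x * y); rewrite ?rmorphM //; exact: PM.
  - move=> _ [x Px ->] [y Py e].
    have /fP[_] : f (x + y) = 0 by rewrite rmorphD -e subrr.
    rewrite opprD => Pxy; apply/eqP; rewrite fI; apply/asboolP; split=> //.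
    by rewrite -(subrK y (- x)); apply: PD.
  - move=> _ _ [x Px ->] [y Py ->]; exists ((x - y) ^+ 2) => //.
    by rewrite rmorphXn rmorphB.
have [C [HC CC Cmax]] := zorn_above C0_cone (@field_cone_chain K).
have [F [i iC]] := maximal_cone_rcf HC Cmax.
have i_surj x : exists y, f x = i y.
  case: (Pt x) => Px.
    have /iC[y _ e] : C (f x) by apply: CC; exists x.
    by exists y.
  have /iC[y _ e] : C (f (- x)) by apply: CC; exists (- x).
  by exists (- y); rewrite rmorphN -e rmorphN opprK.
pose g x := projT1 (cid (i_surj x)).
have gE x : i (g x) = f x by rewrite /g; case: (cid _).
have i_inj := fmorph_inj i.
have g_add : zmod_morphism g.
  by move=> x y; apply: i_inj; rewrite gE !rmorphB /= !gE.
have g_mul : monoid_morphism g.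
  by split=> [|x y]; apply: i_inj; rewrite gE ?rmorph1 // !rmorphM !gE.
pose gA := GRing.isZmodMorphism.Build _ _ g g_add.
pose gM := GRing.isMonoidMorphism.Build _ _ g g_mul.
pose G : {rmorphism A -> F} := HB.pack g gA gM.
exists F, G => x; split=> [Px|gx0].
  have /iC[y y0 e] : C (f x) by apply: CC; exists x.
  by have -> : G x = y by apply: i_inj; rewrite -e -gE.
have Cx : C (f x) by apply/iC; exists (g x).
case: (Pt x) => // Px; have fx0 : f x = 0.
  have [_ _ _ CN _] := HC; apply: CN => //; apply: CC; exists (- x) => //.
  by rewrite rmorphN.
by case: (fP _ fx0).
Qed.

(** * Finite generation of polynomial ideals *)

Lemma nondecreasing_subseq (u : nat -> nat) : exists s : nat -> nat,
  (forall i j, (i < j)%N -> (s i < s j)%N) /\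
  (forall i j, (i <= j)%N -> (u (s i) <= u (s j))%N).
Proof.
have tail m : exists i, (m <= i)%N /\ forall j, (m <= j)%N -> (u i <= u j)%N.
  have ex : exists k, `[< exists2 i, (m <= i)%N & u i = k >].
    by exists (u m); apply/asboolP; exists m.
  case: (ex_minnP ex) => k /asboolP[i mi uik] kmin; exists i; split=> // j mj.
  by rewrite uik; apply: kmin; apply/asboolP; exists j.
have [t tP] := choice tail.
pose s := fix s k := if k is k'.+1 then t (s k').+1 else t 0%N.
have sS k : (s k < s k.+1)%N by have [] := tP (s k).+1.
have s_lt : forall i j, (i < j)%N -> (s i < s j)%N.
  move=> i; elim=> // j IH; rewrite ltnS leq_eqVlt => /orP[/eqP->|/IH ij].
    exact: sS.
  exact: ltn_trans ij (sS j).
exists s; split=> // i j; rewrite leq_eqVlt => /orP[/eqP-> //|/s_lt ij].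
by case: i ij => [|i] ij; apply: (tP _).2 => //; apply: leq_trans (sS i) (ltnW ij).
Qed.

Lemma dickson n (f : nat -> multinom n) :
  exists i j, (i < j)%N /\ forall k, (f i k <= f j k)%N.
Proof.
have : forall m, exists s : nat -> nat,
    (forall i j, (i < j)%N -> (s i < s j)%N) /\
    (forall (k : 'I_n) i j, (k < m)%N -> (i <= j)%N -> (f (s i) k <= f (s j) k)%N);
  last first.
  by move=> /(_ n)[s [s_lt H]]; exists (s 0%N), (s 1%N); split=> [|k]; [exact: s_lt|apply: H].
elim=> [|m [s [s_lt H]]]; first by exists id; split.
have [mn|nm] := ltnP m n; last first.
  by exists s; split=> // k i j _; apply: H; apply: leq_trans nm.
have [t [t_lt Ht]] := nondecreasing_subseq (fun i => f (s i) (Ordinal mn)).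
exists (s \o t); split=> [i j ij|k i j]; first exact/s_lt/t_lt.
rewrite ltnS leq_eqVlt => /orP[/eqP km|km] ij.
  by have -> : k = Ordinal mn; [exact/val_inj|exact: Ht].
apply: H => //; rewrite leq_eqVlt; case: (ltngtP i j) ij => // [ij _|-> _]; last by rewrite eqxx.
by rewrite (t_lt _ _ ij) orbT.
Qed.

Section Ideals.
Variable A : comNzRingType.
Implicit Types (I S : set A) (s : seq A).

Lemma ideal_gen_ideal S : is_ideal (ideal_gen S).
Proof.
split.
- by move=> J [[J0 _ _] _].
- move=> a b Ha Hb J HJ; have [[_ JD _] _] := HJ; apply: JD; [exact: Ha|exact: Hb].
- by move=> c a Ha J HJ; have [[_ _ JM] _] := HJ; apply: JM; apply: Ha.
Qed.

Lemma ideal_gen_sub S : S `<=` ideal_gen S.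
Proof. by move=> x Sx J [_]; apply. Qed.

Lemma ideal_gen_min S I : is_ideal I -> S `<=` I -> ideal_gen S `<=` I.
Proof. by move=> HI SI x; apply. Qed.

Lemma ideal_genS S S' : S `<=` S' -> ideal_gen S `<=` ideal_gen S'.
Proof.
by move=> sub; apply: ideal_gen_min; [exact: ideal_gen_ideal|apply: subset_trans sub (@ideal_gen_sub _)].
Qed.

Lemma idealB I a b : is_ideal I -> I a -> I b -> I (a - b).
Proof. by move=> [_ ID IM] Ia Ib; apply: ID => //; rewrite -mulN1r; apply: IM. Qed.

Lemma ideal_gen_finite S x : ideal_gen S x ->
  exists2 s : seq A, [set` s] `<=` S & ideal_gen [set` s] x.
Proof.
pose I := [set x | exists2 s : seq A, [set` s] `<=` S & ideal_gen [set` s] x].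
move=> Sx; apply: (Sx I); split.
- split.
  + exists [::] => //; by case: (ideal_gen_ideal [set` ([::] : seq A)]).
  + move=> a b [s sS sa] [t tS tb]; exists (s ++ t).
      by move=> y /=; rewrite mem_cat => /orP[/sS|/tS].
    have [_ HD _] := ideal_gen_ideal [set` s ++ t]; apply: HD.
      by apply: ideal_genS sa => y /=; rewrite mem_cat => ->.
    by apply: ideal_genS tb => y /=; rewrite mem_cat => ->; rewrite orbT.
  + move=> c a [s sS sa]; exists s => //.
    by have [_ _ HM] := ideal_gen_ideal [set` s]; apply: HM.
- move=> y Sy; exists [:: y]; first by move=> z /=; rewrite inE => /eqP->.
  by apply: ideal_gen_sub; rewrite /= mem_head.
Qed.

End Ideals.

Section HilbertBasis.
Variables (F : fieldType) (n : nat).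
Local Notation A := (mpoly n F).

Lemma mpoly_ideal_fg (I : set A) : is_ideal I ->
  exists2 s : seq A, [set` s] `<=` I & I `<=` ideal_gen [set` s].
Proof.
move=> HI; apply: contrapT => nfg.
have pick (s : seq A) : exists f, [set` s] `<=` I ->
    [/\ I f, ~ ideal_gen [set` s] f
      & forall g, I g -> ~ ideal_gen [set` s] g -> ~ (mlead g < mlead f)%O].
  have [sI|nsI] := pselect ([set` s] `<=` I); last by exists 0.
  have [f0 [If0 nf0]] : exists f, I f /\ ~ ideal_gen [set` s] f.
    apply: contrapT => H; apply: nfg; exists s => // f If.
    by apply: contrapT => nf; apply: H; exists f.
  move e: (mlead f0) => m; elim/(ltmwf (n := n)): m f0 If0 nf0 e => m IH f If nf e.
  have [[g [Ig ng lt_gf]]|H] := pselect (exists g, [/\ I g, ~ ideal_gen [set` s] g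
      & (mlead g < mlead f)%O]).
    by apply: (IH (mlead g) _ g) => //; rewrite -e.
  by exists f => _; split=> // g Ig ng lt_gf; apply: H; exists g.
have [p pP] := choice pick.
pose s := fix s k := if k is k'.+1 then rcons (s k') (p (s k')) else [::].
have sI k : [set` s k] `<=` I.
  elim: k => [|k IH] //= y; rewrite /= mem_rcons inE => /orP[/eqP->|/IH //].
  by case: (pP _ IH).
have smono i j : (i < j)%N -> p (s i) \in s j.
  elim: j => // j IH; rewrite ltnS leq_eqVlt /= mem_rcons inE => /orP[/eqP->|/IH->].
    by rewrite eqxx.
  by rewrite orbT.
have [i [j [ij le_ij]]] := dickson (fun k => mlead (p (s k))).
have [Ij nj jmin] := pP _ (sI j); have [Ii ni _] := pP _ (sI i).
set f := p (s i) in Ii ni le_ij; set g := p (s j) in Ij nj jmin le_ij.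
have f0 : f != 0.
  by apply/eqP => f0; apply: ni; rewrite f0; case: (ideal_gen_ideal [set` s i]).
pose m := mnm_sub (mlead g) (mlead f).
have mE : mnm_add m (mlead f) = mlead g by apply: submK; apply/mnm_lepP.
pose c := mcoeff (mlead g) g / mcoeff (mlead f) f.
pose h := g - (c *: mpolyX F m) * f.
have fs : ideal_gen [set` s j] f by apply: ideal_gen_sub; apply: smono.
have [_ sD sM] := ideal_gen_ideal [set` s j].
have Ih : I h by apply: idealB => //; case: HI => _ _; apply.
have nh : ~ ideal_gen [set` s j] h.
  by move=> Hh; apply: nj; rewrite -(subrK (c *: mpolyX F m * f) g); apply: sD => //; apply: sM.
have h0 : h != 0 by apply/eqP => h0; apply: nh; rewrite h0; case: (ideal_gen_ideal [set` s j]).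
apply: (jmin h) => //.
have lXf : mlead (mpolyX F m * f) = mlead g.
  have X0 : mpolyX F m != 0 by rewrite -mleadc_eq0 mleadXm mcoeffX eqxx oner_eq0.
  by rewrite (mleadM X0 f0) mleadXm mE.
have cX : mcoeff (mlead g) (mpolyX F m * f) = mcoeff (mlead f) f.
  by rewrite -mE mulrC mcoeffMX.
rewrite lt_neqAle; apply/andP; split.
  apply/eqP => e; have : mcoeff (mlead h) h != 0 by rewrite mleadc_eq0.
  rewrite e mcoeffB -scalerAl mcoeffZ cX divfK ?subrr ?eqxx //.
  by rewrite mleadc_eq0.
rewrite leNgt; apply/negP => lt_gh; have : mcoeff (mlead h) h != 0 by rewrite mleadc_eq0.
by rewrite mcoeffB -scalerAl mcoeffZ !mcoeff_gt_mlead ?lXf // mulr0 subrr eqxx.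
Qed.

Lemma mpoly_gen_finite (S : set A) :
  exists2 s : seq A, [set` s] `<=` S & ideal_gen S `<=` ideal_gen [set` s].
Proof.
have [t tS St] := mpoly_ideal_fg (ideal_gen_ideal S).
have [s sS ts] : exists2 s : seq A, [set` s] `<=` S & [set` t] `<=` ideal_gen [set` s].
  elim: t tS {St} => [|x t IH] tS; first by exists [::].
  have [y yt|s sS ts] := IH; first by apply: tS; rewrite /= inE [_ \in t]yt orbT.
  have [s' s'S xs'] := ideal_gen_finite (tS x (mem_head _ _)).
  exists (s' ++ s); first by move=> y /=; rewrite mem_cat => /orP[/s'S|/sS].
  move=> y; rewrite /= inE => /orP[/eqP->|yt].
    by apply: ideal_genS xs' => z /=; rewrite mem_cat => ->.
  by apply: ideal_genS (ts y yt) => z /=; rewrite mem_cat => ->; rewrite orbT.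
exists s => //; apply: subset_trans St _.
exact: ideal_gen_min (ideal_gen_ideal _) ts.
Qed.

End HilbertBasis.

(** * Weighted top forms *)

Section WeightedForms.
Variables (R : realType) (n : nat) (w : 'rV[R]_n).
Local Notation A := (mpoly n R).
Local Notation B := {poly A}.
Local Notation wd := (wdot w).
Implicit Types (f g : A) (Y Z : B) (P Q : R -> Prop).

Lemma wdotD (a b : multinom n) : wd (mnm_add a b) = wd a + wd b.
Proof.
by rewrite /wdot -big_split; apply: eq_bigr => i _; rewrite mnmDE natrD mulrDr.
Qed.

Lemma wdot0 : wd (mnm0 : multinom n) = 0.
Proof. by rewrite /wdot big1 // => i _; rewrite mnm0E mulr0. Qed.

Definition comp_w (d : R) f : A :=
  \sum_(a <- msupp f | wd a == d) mcoeff a f *: mpolyX R a.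

Lemma mcoeff_comp_w d f a : mcoeff a (comp_w d f) = if wd a == d then mcoeff a f else 0.
Proof.
rewrite /comp_w raddf_sum /=.
have [af|naf] := boolP (a \in msupp f); last first.
  rewrite big_seq_cond big1 ?if_same ?(memN_msupp_eq0 naf) ?if_same //.
  move=> b /andP[bf _]; rewrite mcoeffZ mcoeffX.
  by case: eqP bf naf => [-> -> //|]; rewrite mulr0.
rewrite big_mkcond (bigD1_seq a) //= big1 => [|b ba].
  by case: ifP => _; rewrite ?addr0 // mcoeffZ mcoeffX eqxx mulr1.
by case: ifP => // _; rewrite mcoeffZ mcoeffX (negPf ba) mulr0.
Qed.

Lemma comp_wD d f g : comp_w d (f + g) = comp_w d f + comp_w d g.
Proof.
by apply/mpolyP => a; rewrite !(mcoeffD, mcoeff_comp_w); case: ifP => _; rewrite ?addr0.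
Qed.

Lemma comp_w0 d : comp_w d 0 = 0.
Proof. by apply/mpolyP => a; rewrite mcoeff_comp_w mcoeff0 if_same. Qed.

Lemma comp_w_sum d (T : Type) (r : seq T) (S : pred T) (F : T -> A) :
  comp_w d (\sum_(i <- r | S i) F i) = \sum_(i <- r | S i) comp_w d (F i).
Proof. exact: (big_morph _ (comp_wD d) (comp_w0 d)). Qed.

Lemma comp_w_term d c a :
  comp_w d (c *: mpolyX R a) = if wd a == d then c *: mpolyX R a else 0.
Proof.
apply/mpolyP => b; rewrite mcoeff_comp_w (fun_if (mcoeff b)) mcoeff0 mcoeffZ mcoeffX.
by case: (eqVneq a b) => [->//|_]; rewrite mulr0 !if_same.
Qed.

Lemma comp_w_comp d d' f : comp_w d (comp_w d' f) = if d == d' then comp_w d f else 0.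
Proof.
apply/mpolyP => b; rewrite (fun_if (mcoeff b)) mcoeff0 !mcoeff_comp_w.
by case: (eqVneq d d') => [->|dd']; case: eqP => // ->; rewrite ?eqxx // (negPf dd').
Qed.

Lemma mpoly_sum_ind (Phi : A -> Prop) f : Phi 0 ->
  (forall g h, Phi g -> Phi h -> Phi (g + h)) ->
  (forall a, a \in msupp f -> Phi (mcoeff a f *: mpolyX R a)) -> Phi f.
Proof.
by move=> H0 HD H; rewrite (mpolyE f) big_seq; apply: big_ind.
Qed.

Lemma comp_wX d f a : comp_w d (f * mpolyX R a) = comp_w (d - wd a) f * mpolyX R a.
Proof.
pattern f; apply: mpoly_sum_ind; rewrite ?mul0r ?comp_w0 ?mul0r //.
  by move=> g h; rewrite mulrDl !comp_wD mulrDl => -> ->.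
move=> b _; rewrite -scalerAl -mpolyXD !comp_w_term wdotD eq_sym -subr_eq eq_sym.
by case: ifP; rewrite ?mul0r // -scalerAl -mpolyXD.
Qed.

Definition wdeg_in P f : Prop := forall a, mcoeff a f != 0 -> P (wd a).

Lemma wdeg_in0 P : wdeg_in P 0.
Proof. by move=> a; rewrite mcoeff0 eqxx. Qed.

Lemma wdeg_inD P f g : wdeg_in P f -> wdeg_in P g -> wdeg_in P (f + g).
Proof.
move=> Pf Pg a; rewrite mcoeffD; have [->|/Pf //] := eqVneq (mcoeff a f) 0.
by rewrite add0r => /Pg.
Qed.

Lemma wdeg_in_term P c a : P (wd a) -> wdeg_in P (c *: mpolyX R a).
Proof.
by move=> Pa b; rewrite mcoeffZ mcoeffX; case: (eqVneq a b) => [<-//|_]; rewrite mulr0 eqxx.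
Qed.

Lemma wdeg_in_sub P Q f : (forall v, P v -> Q v) -> wdeg_in P f -> wdeg_in Q f.
Proof. by move=> PQ Pf a /Pf /PQ. Qed.

Lemma wdeg_inX P f a : wdeg_in P f -> wdeg_in (fun v => P (v - wd a)) (f * mpolyX R a).
Proof.
move=> Pf; pattern f; apply: mpoly_sum_ind; first by rewrite mul0r; exact: wdeg_in0.
  by move=> g h; rewrite mulrDl; exact: wdeg_inD.
move=> b bf; rewrite -scalerAl -mpolyXD; apply: wdeg_in_term.
by rewrite wdotD addrK; apply: Pf; rewrite -mcoeff_msupp.
Qed.

Definition wterm (c : R) a k : B := (c *: mpolyX R a)%:P * 'X^k.

Definition weights_in P Y : Prop := forall k, wdeg_in (fun v => P (v + k%:R)) Y`_k.

Lemma weights_in0 P : weights_in P 0.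
Proof. by move=> k; rewrite coef0; exact: wdeg_in0. Qed.

Lemma weights_inD P Y Z : weights_in P Y -> weights_in P Z -> weights_in P (Y + Z).
Proof. by move=> HY HZ k; rewrite coefD; apply: wdeg_inD. Qed.

Lemma weights_in_sum P (T : eqType) (r : seq T) (F : T -> B) :
  {in r, forall i, weights_in P (F i)} -> weights_in P (\sum_(i <- r) F i).
Proof.
move=> H; rewrite big_seq; apply: big_ind; [exact: weights_in0|exact: weights_inD|exact: H].
Qed.

Lemma weights_in_sub P Q Y : (forall v, P v -> Q v) -> weights_in P Y -> weights_in Q Y.
Proof. by move=> PQ H k; apply: wdeg_in_sub (H k) => v; apply: PQ. Qed.

Lemma weights_in_term P c a k : P (wd a + k%:R) -> weights_in P (wterm c a k).
Proof.
move=> H j; rewrite /wterm coefCM coefXn mulr_natr mulrb; case: eqP => [->|_]; last exact: wdeg_in0.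
exact: wdeg_in_term.
Qed.

Lemma weights_in_ind P (Phi : B -> Prop) Y : weights_in P Y -> Phi 0 ->
  (forall Y Z, Phi Y -> Phi Z -> Phi (Y + Z)) ->
  (forall c a k, P (wd a + k%:R) -> Phi (wterm c a k)) -> Phi Y.
Proof.
move=> PY H0 HD H; rewrite -(coefK Y) poly_def; apply: big_ind => // k _.
rewrite (mpolyE Y`_k) scaler_suml big_seq; apply: big_ind => // a aY.
by rewrite -mul_polyC; apply: H; apply: PY; rewrite -mcoeff_msupp.
Qed.

Lemma wtermM c a k c' a' k' :
  wterm c a k * wterm c' a' k' = wterm (c * c') (mnm_add a a') (k + k').
Proof.
rewrite /wterm mulrACA -polyCM -exprD; congr (_%:P * _).
by rewrite -scalerAl -scalerAr scalerA -mpolyXD.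
Qed.

Lemma weights_inM P Q S Y Z : weights_in P Y -> weights_in Q Z ->
  (forall u v, P u -> Q v -> S (u + v)) -> weights_in S (Y * Z).
Proof.
move=> PY QZ H; pattern Y; apply: (weights_in_ind PY) => [|Y1 Y2|c a k Pa].
- by rewrite mul0r; exact: weights_in0.
- by rewrite mulrDl; exact: weights_inD.
pattern Z; apply: (weights_in_ind QZ) => [|Z1 Z2|c' a' k' Qa].
- by rewrite mulr0; exact: weights_in0.
- by rewrite mulrDr; exact: weights_inD.
by rewrite wtermM; apply: weights_in_term; rewrite wdotD natrD addrACA; apply: H.
Qed.

(* The top form of degree [d] for the weights [w] of the [x_i] and [1] of the
   parameter T, dehomogenised by T = 1. *)
Definition top_form (d : R) Y : A := \sum_(k < size Y) comp_w (d - k%:R) Y`_k.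

Lemma top_form_widen d Y m : (size Y <= m)%N -> top_form d Y = \sum_(k < m) comp_w (d - k%:R) Y`_k.
Proof.
move=> le_m; rewrite /top_form (big_ord_widen m (fun k => comp_w (d - k%:R) Y`_k)) //.
rewrite big_mkcond; apply: eq_bigr => k _.
by case: ltnP => // le; rewrite nth_default // comp_w0.
Qed.

Lemma top_formD d Y Z : top_form d (Y + Z) = top_form d Y + top_form d Z.
Proof.
pose m := maxn (size Y) (size Z).
rewrite (top_form_widen d (size_polyD Y Z : _ <= m)%N) (@top_form_widen d Y m) ?leq_maxl //.
rewrite (@top_form_widen d Z m) ?leq_maxr // -big_split; apply: eq_bigr => k _ /=.
by rewrite coefD comp_wD.
Qed.

Lemma top_form0 d : top_form d 0 = 0.
Proof. by rewrite /top_form size_poly0 big_ord0. Qed.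

Lemma top_form_sum d (T : Type) (r : seq T) (S : pred T) (F : T -> B) :
  top_form d (\sum_(i <- r | S i) F i) = \sum_(i <- r | S i) top_form d (F i).
Proof. exact: (big_morph _ (top_formD d) (top_form0 d)). Qed.

Lemma top_form_term d c a k :
  top_form d (wterm c a k) = if wd a + k%:R == d then c *: mpolyX R a else 0.
Proof.
rewrite (@top_form_widen d _ k.+1); last first.
  by rewrite /wterm mul_polyC (leq_trans (size_scale_leq _ _)) // size_polyXn.
rewrite big_ord_recr big1 /= => [|i _]; last first.
  by rewrite /wterm coefCM coefXn (ltn_eqF (ltn_ord i)) mulr0 comp_w0.
rewrite add0r /wterm coefCM coefXn eqxx mulr1 comp_w_term.
by rewrite eq_sym subr_eq eq_sym.
Qed.

Lemma top_formM d d' Y Z :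
  weights_in (fun v => v <= d) Y -> weights_in (fun v => v <= d') Z ->
  top_form (d + d') (Y * Z) = top_form d Y * top_form d' Z.
Proof.
move=> HY HZ; pattern Y; apply: (weights_in_ind HY) => [|Y1 Y2|c a k le_d].
- by rewrite !(mul0r, top_form0).
- by rewrite mulrDl !top_formD mulrDl => -> ->.
pattern Z; apply: (weights_in_ind HZ) => [|Z1 Z2|c' a' k' le_d'].
- by rewrite !(mulr0, top_form0).
- by rewrite mulrDr !top_formD mulrDr => -> ->.
rewrite wtermM !top_form_term wdotD natrD addrACA.
have [e|ne] := eqVneq (wd a + k%:R) d; have [e'|ne'] := eqVneq (wd a' + k'%:R) d'.
- by rewrite e e' eqxx -scalerAl -scalerAr scalerA -mpolyXD.
- by rewrite mulr0 e (inj_eq (addrI _)) (negPf ne').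
- by rewrite mul0r e' (inj_eq (addIr _)) (negPf ne).
rewrite mul0r; case: eqP => // e; exfalso.
have : wd a + k%:R < d by rewrite lt_neqAle ne.
by move: e le_d'; lra.
Qed.

Lemma comp_top_form d k Y : comp_w (d - k%:R) (top_form d Y) = comp_w (d - k%:R) Y`_k.
Proof.
pose m := maxn (size Y) k.+1.
rewrite (@top_form_widen d Y m) ?leq_maxl // comp_w_sum.
have km : (k < m)%N by rewrite leq_maxr.
rewrite (bigD1 (Ordinal km)) //= big1 => [|i ik]; rewrite comp_w_comp ?eqxx ?addr0 //.
rewrite (inj_eq (addrI _)) (inj_eq oppr_inj) eqr_nat eq_sym.
by case: (eqVneq (i : nat) k) ik => // e; rewrite -(inj_eq val_inj) /= e eqxx.
Qed.

Lemma le_deg_w f a : a \in msupp f -> wd a <= deg_w w f.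
Proof.
rewrite /deg_w; elim: (msupp f) => // b r IH.
by rewrite big_cons inE le_max => /orP[/eqP->|/IH->]; rewrite ?lexx ?orbT.
Qed.

Lemma deg_w_eq f d : wdeg_in (fun v => v <= d) f -> comp_w d f != 0 -> deg_w w f = d.
Proof.
move=> fd c0; have [a a_f a_d] : exists2 a, a \in msupp f & wd a = d.
  apply: contrapT => H; move/eqP: c0; apply; rewrite /comp_w big_seq_cond big1 // => a.
  by move=> /andP[af /eqP ad]; case: H; exists a.
have f0 : f != 0 by apply: contraNneq c0 => ->; rewrite comp_w0.
apply/le_anti/andP; split; last by rewrite -a_d le_deg_w.
rewrite /deg_w big_seq; apply: bigmax_le => [|b b_f]; apply: fd; last by rewrite -mcoeff_msupp.
by rewrite mleadc_eq0.
Qed.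

Lemma wdeg_in_deg_w f : wdeg_in (fun v => v <= deg_w w f) f.
Proof. by move=> a; rewrite -mcoeff_msupp; exact: le_deg_w. Qed.

Lemma in_w_comp f : in_w w f = comp_w (deg_w w f) f.
Proof. by []. Qed.

Variable I : set A.
Hypothesis I_ideal : is_ideal I.
Local Notation J := (in_w_ideal w I).

Lemma comp_w_in_ideal f d : I f -> wdeg_in (fun v => v <= d) f -> J (comp_w d f).
Proof.
move=> If fd; have [->|c0] := eqVneq (comp_w d f) 0.
  by case: (ideal_gen_ideal [set in_w w f | f in I]).
rewrite -(deg_w_eq fd c0) -in_w_comp; apply: ideal_gen_sub; by exists f.
Qed.

Definition poly_ideal : set B := [set Y | forall k, I Y`_k].

Lemma poly_ideal_ideal : is_ideal poly_ideal.
Proof.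
have [I0 ID IM] := I_ideal; split.
- by move=> k; rewrite coef0.
- by move=> Y Z HY HZ k; rewrite coefD; apply: ID.
- move=> Z Y HY k; rewrite coefM; apply: big_ind => // i _; exact: IM.
Qed.

Lemma top_form_in_ideal Y d : poly_ideal Y -> weights_in (fun v => v <= d) Y -> J (top_form d Y).
Proof.
have [J0 JD _] := ideal_gen_ideal [set in_w w f | f in I].
move=> HY Yd; apply: big_ind => // k _; apply: comp_w_in_ideal; first exact: HY.
by apply: wdeg_in_sub (Yd k) => v; rewrite lerBrDr.
Qed.

Lemma min_gap (r : seq R) : exists2 d : R, 0 < d & {in r, forall x, 0 < x -> d <= x}.
Proof.
elim: r => [|x r [d d0 H]]; first by exists 1.
have [x0|x0] := ltP 0 x.
  exists (Num.min d x); first by rewrite lt_min d0.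
  move=> y; rewrite inE => /orP[/eqP->|yr y0]; first by rewrite ge_min lexx orbT.
  by rewrite ge_min H.
exists d => // y; rewrite inE => /orP[/eqP->|]; last exact: H.
by move=> /lt_le_trans /(_ x0); rewrite ltxx.
Qed.

Lemma lift_gens (s : seq A) : [set` s] `<=` [set in_w w f | f in I] ->
  exists2 d : R, 0 < d & {in s, forall h, exists f, [/\ I f, in_w w f = h
    & wdeg_in (fun v => v = deg_w w f \/ v <= deg_w w f - d) f]}.
Proof.
elim: s => [|h s IH] sI; first by exists 1.
have [|d d0 Hd] := IH; first by move=> y /= ys; apply: sI; rewrite /= inE ys orbT.
have [f If fh] := sI h (mem_head _ _).
have [d' d'0 Hd'] := min_gap [seq deg_w w f - wd a | a <- msupp f].
exists (Num.min d d'); first by rewrite lt_min d0.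
move=> y; rewrite inE => /orP[/eqP->|/Hd[g [Ig gy gd]]]; last first.
  exists g; split=> //; apply: wdeg_in_sub gd => v [->|H]; [by left|right].
  by apply: le_trans H _; rewrite lerD2l lerN2 ge_min lexx.
exists f; split=> // a a_f; have := wdeg_in_deg_w a_f; rewrite le_eqVlt => /orP[/eqP->|lt_a].
  by left.
right; rewrite lerBrDl -lerBrDr ge_min; apply/orP; right; apply: Hd'.
  by apply: map_f; rewrite mcoeff_msupp.
by rewrite subr_gt0.
Qed.

Lemma initial_lift : exists2 d : R, 0 < d & forall y, J y -> forall e,
  exists F, [/\ I F, comp_w e F = comp_w e y & wdeg_in (fun v => v = e \/ v <= e - d) F].
Proof.
have [s sS Ss] := mpoly_gen_finite [set in_w w f | f in I].
have [d d0 Hd] := lift_gens sS; exists d => //.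
have [I0 ID IM] := I_ideal.
pose W := [set y | forall e, exists F,
  [/\ I F, comp_w e F = comp_w e y & wdeg_in (fun v => v = e \/ v <= e - d) F]].
have W0 : W 0 by move=> e; exists 0; split=> //; exact: wdeg_in0.
have WD y z : W y -> W z -> W (y + z).
  move=> Wy Wz e; have [F [IF Fy Fm]] := Wy e; have [G [IG Gz Gm]] := Wz e.
  by exists (F + G); split; [exact: ID|rewrite !comp_wD Fy Gz|exact: wdeg_inD].
have W_ideal : is_ideal W.
  split=> // c y Wy; rewrite (mpolyE c) mulr_suml; apply: big_ind => // a _ e.
  have [F [IF Fy Fm]] := Wy (e - wd a).
  have comE g : mcoeff a c *: mpolyX R a * g = (mpolyC n (mcoeff a c) * g) * mpolyX R a.
    by rewrite -mul_mpolyC mulrAC.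
  have compC (e' : R) (k : R) g : comp_w e' (mpolyC n k * g) = mpolyC n k * comp_w e' g.
    apply/mpolyP => b; rewrite mcoeffCM !mcoeff_comp_w mcoeffCM.
    by case: ifP => // _; rewrite mulr0.
  exists (mcoeff a c *: mpolyX R a * F); split; first exact: IM.
    by rewrite !comE !comp_wX !compC Fy.
  rewrite comE; apply: wdeg_in_sub (wdeg_inX (a := a) (_ : wdeg_in (fun v => v = e - wd a \/ v <= e - wd a - d) _)).
    move=> v [H|H]; [left|right]; first by apply: (addIr (- wd a)).
    by move: H; lra.
  by move=> b; rewrite mcoeffCM mulf_eq0 negb_or => /andP[_] /Fm.
have sW : [set` s] `<=` W.
  move=> h /Hd[f [If <- fm]] e; have [<-|ne] := eqVneq (deg_w w f) e.
    by exists f; split=> //; rewrite in_w_comp comp_w_comp eqxx.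
  exists 0; split=> //; last exact: wdeg_in0.
  by rewrite comp_w0 in_w_comp comp_w_comp eq_sym (negPf ne).
by move=> y /Ss /(ideal_gen_min W_ideal sW).
Qed.

(* Cancelling the top form of [Y] by an element of the ideal lowers the degree
   by the uniform gap [d], apart from the terms that [Y] already had. *)
Lemma lower_top : exists2 d : R, 0 < d & forall P Y e (nu : multinom n),
  weights_in P Y -> J (mpolyX R nu * top_form e Y) ->
  exists2 F, poly_ideal F &
    weights_in (fun v => v - wd nu != e /\ (P (v - wd nu) \/ v - wd nu <= e - d))
      (Y * (mpolyX R nu)%:P - F).
Proof.
have [d d0 Hd] := initial_lift; exists d => // P Y e nu PY JY.
have /choice[G HG] : forall k : nat, exists F, [/\ I F,
    comp_w (e + wd nu - k%:R) F = comp_w (e + wd nu - k%:R) (Y`_k * mpolyX R nu)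
    & wdeg_in (fun v => v = e + wd nu - k%:R \/ v <= e + wd nu - k%:R - d) F].
  move=> k; have [F [IF Fy Fm]] := Hd _ JY (e + wd nu - k%:R).
  exists F; split=> //; rewrite Fy mulrC !comp_wX.
  have -> : e + wd nu - k%:R - wd nu = e - k%:R by ring.
  by rewrite comp_top_form.
exists (\poly_(k < size Y) G k) => [k|k a].
  by rewrite coef_poly; case: ifP => _; [have [] := HG k|case: I_ideal].
rewrite coefB coefMC coef_poly mcoeffB.
have [lt_k|le_k] := ltnP; last by rewrite nth_default // mul0r mcoeff0 subrr eqxx.
have [IF Fy Fm] := HG k.
have := congr1 (mcoeff a) Fy; rewrite !mcoeff_comp_w => ce c0.
have nv : wd a + k%:R - wd nu != e.
  apply: contraNneq c0 => ae; move: ce; have -> : wd a = e + wd nu - k%:R by rewrite -ae; ring.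
  by rewrite eqxx => ->; rewrite subrr.
split=> //; have [c1|c1] := eqVneq (mcoeff a (Y`_k * mpolyX R nu)) 0.
  right; move: c0; rewrite c1 sub0r oppr_eq0 => /Fm[ae|]; last by lra.
  by case/negP: nv; apply/eqP; rewrite ae; ring.
left; have := wdeg_inX (a := nu) (PY k) c1.
by have -> : wd a - wd nu + k%:R = wd a + k%:R - wd nu by ring.
Qed.

End WeightedForms.

(** * Descent on the weighted degree *)

Section PreorderOfFamily.
Variables (B : comNzRingType) (Ix : finType) (G : Ix -> B).

Definition pprod (e : {ffun Ix -> bool}) : B := \prod_i G i ^+ e i.

Definition preorder_mod (I : set B) : set B :=
  [set b | exists l : seq ({ffun Ix -> bool} * B),
     I (b - \sum_(t <- l) pprod t.1 * t.2 ^+ 2)].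

End PreorderOfFamily.

Lemma preorder_basis_seq (A : comNzRingType) s (p : 'I_s -> A) (J : set A) :
  preorder_basis p J -> forall l : seq ({ffun 'I_s -> bool} * A),
  J (\sum_(t <- l) pprod p t.1 * t.2 ^+ 2) -> {in l, forall t, J t.2}.
Proof.
move=> PO l Jl t tl.
pose ys e := [seq u.2 | u <- l & u.1 == e].
apply: (PO ys _ t.1); last by apply/mapP; exists t; rewrite // mem_filter eqxx.
suff -> : \sum_e \sum_(y <- ys e) (\prod_(i < s) p i ^+ e i) * y ^+ 2 =
  \sum_(t <- l) pprod p t.1 * t.2 ^+ 2 by [].
rewrite [RHS](partition_big (fun t => t.1) xpredT) //=; apply: eq_bigr => e _.
rewrite big_map big_filter; apply: eq_bigr => u /eqP <- //.
Qed.

Section Descent.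
Variables (R : realType) (n : nat) (w : 'rV[R]_n).
Local Notation A := (mpoly n R).
Local Notation B := {poly A}.
Local Notation wd := (wdot w).
Variable I : set A.
Hypothesis I_ideal : is_ideal I.
Local Notation J := (in_w_ideal w I).
Variables (s : nat) (p : 'I_s -> A) (Kx : finType).
Variables (G : 'I_s + Kx -> B) (gam : 'I_s + Kx -> R) (alp : Kx -> multinom n).
Hypothesis PO : preorder_basis p J.
Hypothesis J_nomon : forall a : multinom n, ~ J (mpolyX R a).
Hypothesis G_weights : forall i, weights_in w (fun v => v <= gam i) (G i).
Hypothesis G_inl : forall i, top_form w (gam (inl i)) (G (inl i)) = p i.
Hypothesis G_inr : forall k, top_form w (gam (inr k)) (G (inr k)) = mpolyX R (alp k) ^+ 2.

Let Ix := ('I_s + Kx)%type.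
Implicit Types (e : {ffun Ix -> bool}) (l : seq ({ffun Ix -> bool} * B)).

Definition gamp e : R := \sum_(i : Ix) gam i *+ e i.
Definition xalp e : A := \prod_k mpolyX R (alp k) ^+ e (inr k).
Definition restl e : {ffun 'I_s -> bool} := [ffun i => e (inl i)].
Definition nu : multinom n := \big[mnm_add/mnm0]_k alp k.

Lemma xalp_dvd e : exists z, mpolyX R nu = z * xalp e.
Proof.
exists (\prod_k mpolyX R (alp k) ^+ (~~ e (inr k))).
have -> : mpolyX R nu = \prod_k mpolyX R (alp k) by rewrite /nu -mprodXE.
by rewrite /xalp -big_split; apply: eq_bigr => k _ /=; rewrite -exprD; case: (e _).
Qed.

Lemma weights_in_ini1 : weights_in w (fun v => v <= 0) (1 : B) /\ top_form w 0 (1 : B) = 1.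
Proof.
have -> : (1 : B) = wterm 1 mnm0 0 by rewrite /wterm expr0 mulr1 scale1r mpolyX0.
split; first by apply: weights_in_term; rewrite wdot0 addr0.
by rewrite top_form_term wdot0 addr0 eqxx scale1r mpolyX0.
Qed.

Lemma top_form_pprod e : weights_in w (fun v => v <= gamp e) (pprod G e) /\
  top_form w (gamp e) (pprod G e) = pprod p (restl e) * xalp e ^+ 2.
Proof.
have -> : pprod p (restl e) * xalp e ^+ 2 =
    \prod_(i : Ix) top_form w (gam i) (G i) ^+ e i.
  rewrite [RHS]big_sumType /=; congr (_ * _).
    by apply: eq_bigr => i _; rewrite G_inl ffunE.
  by rewrite /xalp -prodrXl; apply: eq_bigr => k _; rewrite G_inr -!exprM mulnC.
rewrite /gamp /pprod.
apply: (big_ind3 (fun Y g q => weights_in w (fun v => v <= g) Y /\ top_form w g Y = q)).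
- exact: weights_in_ini1.
- move=> Y1 g1 q1 Y2 g2 q2 [s1 <-] [s2 <-]; split; last exact: top_formM.
  by apply: weights_inM s1 s2 _ => u v; exact: lerD.
- move=> i _; case: (e i); rewrite ?expr0 ?expr1 ?mulr0n ?mulr1n; last exact: weights_in_ini1.
  by split.
Qed.

Let c := wd nu.
Let xm m : A := mpolyX R nu ^+ m.

Lemma wdot_muln (a : multinom n) m : wd (mnm_muln a m) = m%:R * wd a.
Proof.
elim: m => [|m IH]; first by rewrite mulm0n wdot0 mul0r.
by rewrite mulmS wdotD IH -natr1; ring.
Qed.

Lemma xm_wterm m : (xm m)%:P = wterm 1 (mnm_muln nu m) 0 :> B.
Proof. by rewrite /wterm expr0 mulr1 scale1r /xm mpolyXn. Qed.

(* The relation [-1 = sum_t G^t.1 * t.2^2] modulo the ideal, multiplied by the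
   square of the monomial [xm m].  In [values], the weight of a wterm of [t.2] is
   shifted so that it is nonpositive exactly when the corresponding wterm of
   [G^t.1 * t.2^2] does not exceed the weight of [xm m ^+ 2]. *)
Definition rel m l : Prop :=
  poly_ideal I ((xm m)%:P ^+ 2 + \sum_(t <- l) pprod G t.1 * t.2 ^+ 2).

Definition values m l (Q : R -> Prop) : Prop :=
  {in l, forall t, weights_in w (fun v => Q (v + gamp t.1 / 2 - m%:R * c)) t.2}.

Lemma rel_top m l D : 0 <= D -> rel m l -> values m l (fun v => v <= D) ->
  J ((if D == 0 then xm m ^+ 2 else 0) +
     \sum_(t <- l) pprod p (restl t.1) *
       (xalp t.1 * top_form w (D - gamp t.1 / 2 + m%:R * c) t.2) ^+ 2).
Proof.
move=> D0 Hrel vals; pose E := (D + m%:R * c) + (D + m%:R * c).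
pose del (t : {ffun Ix -> bool} * B) := D - gamp t.1 / 2 + m%:R * c.
have EE t : E = gamp t.1 + (del t + del t) by rewrite /E /del; field.
have sx : weights_in w (fun v => v <= D + m%:R * c) (xm m)%:P.
  by rewrite xm_wterm; apply: weights_in_term; rewrite wdot_muln addr0 lerDr.
have st t : t \in l -> weights_in w (fun v => v <= del t) t.2.
  by move=> tl; apply: weights_in_sub (vals t tl) => v; rewrite /del; lra.
have sq u v Y : weights_in w (fun v => v <= u) Y -> u + u = v -> weights_in w (fun x => x <= v) (Y ^+ 2).
  by move=> sY <-; rewrite expr2; apply: (weights_inM sY sY) => x y; exact: lerD.
have sE : weights_in w (fun v => v <= E)
    ((xm m)%:P ^+ 2 + \sum_(t <- l) pprod G t.1 * t.2 ^+ 2).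
  apply: weights_inD; first exact: sq sx _.
  apply: weights_in_sum => t tl; have [sG _] := top_form_pprod t.1.
  by apply: (weights_inM sG (sq _ _ _ (st t tl) erefl)) => x y; rewrite (EE t); exact: lerD.
have := top_form_in_ideal Hrel sE; rewrite top_formD top_form_sum; congr (J (_ + _)).
  rewrite expr2 top_formM // xm_wterm top_form_term wdot_muln.
  have -> : (m%:R * wd nu + 0 == D + m%:R * c) = (D == 0).
    by apply/eqP/eqP; rewrite /c; lra.
  case: ifP => _; last by rewrite mul0r.
  by rewrite scale1r -expr2 -mpolyXn.
rewrite !big_seq; apply: eq_bigr => t tl; have [sG iG] := top_form_pprod t.1.
rewrite (EE t) top_formM //; last exact: sq (st t tl) _.
by rewrite [t.2 ^+ 2]expr2 (top_formM (st t tl) (st t tl)) iG; ring.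
Qed.

Lemma descent_step : exists2 d : R, 0 < d & forall m l D (Q : R -> Prop),
  0 < D -> rel m l -> values m l (fun v => v <= D) -> values m l Q ->
  exists2 l', rel m.+1 l'
    & values m.+1 l' (fun v => v != D /\ (Q v \/ v <= D - d)).
Proof.
have [d d0 low] := lower_top w I_ideal; exists d => // m l D Q D0 Hrel vD vQ.
pose del (t : {ffun Ix -> bool} * B) := D - gamp t.1 / 2 + m%:R * c.
have [J0 JD JM] := ideal_gen_ideal [set in_w w f | f in I].
have Jt t : t \in l -> J (mpolyX R nu * top_form w (del t) t.2).
  move=> tl; have := rel_top (ltW D0) Hrel vD; rewrite gt_eqF // add0r.
  rewrite -(big_map (fun t => (restl t.1, xalp t.1 * top_form w (del t) t.2)) xpredT
    (fun t => pprod p t.1 * t.2 ^+ 2)).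
  move=> /(preorder_basis_seq PO) H.
  have [z ->] := xalp_dvd t.1; rewrite -mulrA; apply: JM.
  exact: (H (restl t.1, xalp t.1 * top_form w (del t) t.2) (map_f _ tl)).
have /choice[F HF] : forall t, exists F, t \in l -> poly_ideal I F /\
    weights_in w (fun v => v - c != del t /\ (Q (v - c + gamp t.1 / 2 - m%:R * c) \/
      v - c <= del t - d)) (t.2 * (mpolyX R nu)%:P - F).
  move=> t; case: (boolP (t \in l)) => [tl|_]; last by exists 0.
  by have [F IF sF] := low _ _ (del t) nu (vQ t tl) (Jt t tl); exists F.
have [I0 ID IM] := poly_ideal_ideal I_ideal.
exists [seq (t.1, t.2 * (mpolyX R nu)%:P - F t) | t <- l].
  rewrite /rel big_map /=.
  have -> : (xm m.+1)%:P ^+ 2 + \sum_(t <- l) pprod G t.1 *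
       (t.2 * (mpolyX R nu)%:P - F t) ^+ 2 =
     (mpolyX R nu)%:P ^+ 2 * ((xm m)%:P ^+ 2 + \sum_(t <- l) pprod G t.1 * t.2 ^+ 2) +
     \sum_(t <- l) (pprod G t.1 * (F t - t.2 * (mpolyX R nu)%:P *+ 2)) * F t.
    rewrite mulrDr -addrA; congr (_ + _).
      by rewrite -exprMn -polyCM -exprS.
    rewrite mulr_sumr -big_split; apply: eq_bigr => t _ /=.
    by ring.
  apply: (ID); first exact: IM.
  rewrite big_seq; apply: big_ind => // t tl; apply: IM.
  by have [] := HF t tl.
move=> _ /mapP[t tl ->] /=; have [_] := HF t tl; apply: weights_in_sub => v [ne H].
have e : v + gamp t.1 / 2 - m.+1%:R * c = v - c + gamp t.1 / 2 - m%:R * c.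
  by rewrite -natr1; ring.
rewrite e; split.
  by apply: contraNneq ne => veD; apply/eqP; rewrite /del -veD; field.
by case: H => [|H]; [left|right; move: H; rewrite /del; lra].
Qed.

Lemma values_and m l P Q : values m l P -> values m l Q ->
  values m l (fun v => P v /\ Q v).
Proof. by move=> vP vQ t tl k a a0; split; [exact: (vP t tl)|exact: (vQ t tl)]. Qed.

Lemma values_sub m l P Q : (forall v, P v -> Q v) -> values m l P -> values m l Q.
Proof. by move=> PQ vP t tl; apply: weights_in_sub (vP t tl) => v; apply: PQ. Qed.

Lemma values_finite m l : exists L : seq R, values m l (fun v => v \in L).
Proof.
pose vl (Y : B) := [seq wd a + k%:R | k <- iota 0 (size Y), a <- msupp Y`_k].
exists (flatten [seq [seq v + gamp t.1 / 2 - m%:R * c | v <- vl t.2] | t <- l]).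
move=> t tl k a a0; apply/flattenP.
exists [seq v + gamp t.1 / 2 - m%:R * c | v <- vl t.2]; first exact: map_f.
apply: (map_f (fun v => v + gamp t.1 / 2 - m%:R * c)).
apply/allpairsPdep; exists k, a; split; rewrite ?mcoeff_msupp //.
rewrite mem_iota /= add0n ltnNge; apply: contraNN a0 => le_k.
by rewrite nth_default // mcoeff0.
Qed.

Lemma max_mem (L : seq R) : L != [::] -> exists2 D, D \in L & {in L, forall v, v <= D}.
Proof.
elim: L => // x L IH _; have [->|/IH[D DL HD]] := eqVneq L [::].
  by exists x; rewrite ?mem_head // => v; rewrite mem_seq1 => /eqP->.
have [le|lt] := leP x D.
  by exists D; rewrite ?inE ?DL ?orbT // => v; rewrite inE => /orP[/eqP->|/HD].
exists x; rewrite ?mem_head // => v; rewrite inE => /orP[/eqP-> //|/HD vD].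
exact: le_trans vD (ltW lt).
Qed.

Lemma rel_false m l : ~ rel m l.
Proof.
have [d d0 step] := descent_step.
have claim N m' l' : rel m' l' -> ~ values m' l' (fun v => v <= d * N%:R).
  elim: N m' l' => [|N IHN] {}m {}l Hrel vals.
    move: vals; rewrite mulr0 => vals; have := rel_top (lexx 0) Hrel vals.
    rewrite eqxx => H.
    pose l0 := ([ffun=> false] : {ffun 'I_s -> bool}, xm m) :: [seq (restl t.1, xalp t.1 *
      top_form w (0 - gamp t.1 / 2 + m%:R * c) t.2) | t <- l].
    have /(preorder_basis_seq PO) : J (\sum_(t <- l0) pprod p t.1 * t.2 ^+ 2).
      rewrite /l0 big_cons big_map /= /pprod.
      by rewrite big1 => [|i _]; rewrite ?ffunE ?expr0 // mul1r.
    move=> /(_ _ (mem_head _ _)) /=; rewrite /xm mpolyXn.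
    exact: J_nomon.
  have [L0 vL0] := values_finite m l.
  have : values m l (fun v => v <= d * N%:R \/ v \in [seq v <- L0 | v <= d * N.+1%:R]).
    apply: values_sub (values_and vals vL0) => v [le vL]; right.
    by rewrite mem_filter le.
  have : {in [seq v <- L0 | v <= d * N.+1%:R], forall v, v <= d * N.+1%:R}.
    by move=> v; rewrite mem_filter => /andP[].
  move: [seq v <- L0 | _] => L; have [k] := ubnP (size L).
  elim: k L m l Hrel {vals L0 vL0} => // k IHk L m l Hrel lt_k LN vL.
  have [L0|/max_mem[D DL HD]] := eqVneq L [::].
    by apply: (IHN m l Hrel); apply: values_sub vL => v []; rewrite // L0.
  pose L' := [seq v <- L | v != D].
  have lt_L' : (size L' < k)%N.
    rewrite -ltnS; apply: leq_trans lt_k; rewrite ltnS size_filter.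
    rewrite -(count_predC (fun v => v != D) L) -addn1 leq_add2l -has_count.
    by apply/hasP; exists D; rewrite //= negbK.
  have L'N : {in L', forall v, v <= d * N.+1%:R}.
    by move=> v; rewrite mem_filter => /andP[_ /LN].
  have [leD|ltD] := leP D (d * N%:R).
    apply: (IHk L' m l) => //; apply: values_sub vL => v [|vLL]; [by left|].
    by have [->|vD] := eqVneq v D; [left|right; rewrite mem_filter vD].
  have D0 : 0 < D by apply: le_lt_trans ltD; rewrite mulr_ge0 ?ler0n ?(ltW d0).
  have vD : values m l (fun v => v <= D).
    by apply: values_sub vL => v [le|/HD //]; apply: le_trans le (ltW ltD).
  have [l' Hrel' vl'] := step m l D _ D0 Hrel vD vL.
  apply: (IHk L' m.+1 l') => //; apply: values_sub vl' => v [vne [[|vLL]|le]].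
  - by left.
  - by right; rewrite mem_filter vne.
  - left; apply: le_trans le _; have := LN D DL; rewrite -natr1; lra.
move=> Hrel; have [L vL] := values_finite m l.
have [N HN] : exists N, {in L, forall v, v <= d * N%:R}.
  elim: (L) => [|x r [N HN]]; first by exists 0%N.
  exists (maxn N (Num.bound `|x / d|)) => v; rewrite inE => /orP[/eqP->|/HN vN].
    rewrite mulrC -ler_pdivrMr //.
    apply: (@le_trans _ _ (Num.bound `|x / d|)%:R); last by rewrite ler_nat leq_maxr.
    exact: le_trans (ler_norm _) (ltW (archi_boundP (normr_ge0 _))).
  by apply: le_trans vN _; rewrite ler_pM2l // ler_nat leq_maxl.
by apply: (claim N m l Hrel); apply: values_sub vL => v /HN.
Qed.

Lemma descent_proper : ~ preorder_mod G (poly_ideal I) (- 1).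
Proof.
move=> [l]; rewrite -opprD => H; apply: (@rel_false 0 l); rewrite /rel /xm expr0.
have [_ _ IM] := poly_ideal_ideal I_ideal.
have := IM (- 1) _ H; rewrite mulN1r opprK; congr (poly_ideal I (_ + _)).
by rewrite polyC1 expr1n.
Qed.

End Descent.

(** * Real points from prime cones *)

Lemma preorder_mod_preordering (B : comNzRingType) (Ix : finType) (G : Ix -> B)
    (I : set B) : is_ideal I -> ~ preorder_mod G I (- 1) ->
  preordering (preorder_mod G I).
Proof.
move=> HI n1; have [I0 ID IM] := HI; split=> //.
- move=> x; exists [:: ([ffun=> false], x)]; rewrite big_seq1 /pprod big1 => [|i _].
    by rewrite mul1r subrr.
  by rewrite ffunE expr0.
- move=> x y [l Hl] [l' Hl']; exists (l ++ l'); rewrite big_cat /=.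
  by rewrite opprD addrACA; apply: ID.
- move=> x y [l Hl] [l' Hl'].
  pose mulp (t u : {ffun Ix -> bool} * B) : {ffun Ix -> bool} * B :=
    ([ffun i => t.1 i (+) u.1 i], pprod G [ffun i => t.1 i && u.1 i] * (t.2 * u.2)).
  exists [seq mulp t u | t <- l, u <- l'].
  set S := (X in _ - X); pose S1 := \sum_(t <- l) pprod G t.1 * t.2 ^+ 2.
  pose S2 := \sum_(t <- l') pprod G t.1 * t.2 ^+ 2.
  have -> : S = S1 * S2.
    rewrite /S big_allpairs_dep big_distrlr /=; apply: eq_bigr => t _; apply: eq_bigr => u _.
    rewrite /mulp /= exprMn [LHS]mulrA.
    have -> : pprod G [ffun i => t.1 i (+) u.1 i] * pprod G [ffun i => t.1 i && u.1 i] ^+ 2 =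
        pprod G t.1 * pprod G u.1.
      rewrite /pprod -prodrXl -!big_split /=; apply: eq_bigr => i _; rewrite !ffunE.
      by case: (t.1 i); case: (u.1 i); rewrite /= ?expr0 ?expr1 ?expr1n ?mulr1 ?mul1r.
    by rewrite exprMn mulrACA.
  have -> : x * y - S1 * S2 = x * (y - S2) + S2 * (x - S1) by ring.
  by apply: ID; apply: IM.
Qed.

Lemma preorder_mod_gen (B : comNzRingType) (Ix : finType) (G : Ix -> B) (I : set B) i :
  is_ideal I -> preorder_mod G I (G i).
Proof.
move=> [I0 _ _]; exists [:: ([ffun j => j == i], 1)].
rewrite big_seq1 /= expr1n mulr1 /pprod (bigD1 i) //= ffunE eqxx expr1.
by rewrite big1 ?mulr1 ?subrr // => j ji; rewrite ffunE (negPf ji) expr0.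
Qed.

Lemma preorder_mod_ideal (B : comNzRingType) (Ix : finType) (G : Ix -> B) (I : set B) :
  I `<=` preorder_mod G I.
Proof. by move=> b Ib; exists [::]; rewrite big_nil subr0. Qed.

Lemma rmorph_int_eval (C D : comNzRingType) m (f : {rmorphism C -> D}) (v : nat -> C)
    (q : mpoly m int) : f (int_eval v q) = int_eval (fun i => f (v i)) q.
Proof.
rewrite /int_eval /mmap rmorph_sum; apply: eq_bigr => a _.
rewrite rmorphM rmorph_int /mmap1 rmorph_prod; congr (_ * _).
by apply: eq_bigr => i _; rewrite rmorphXn.
Qed.

Definition int_var m (i : nat) : mpoly m int :=
  if insub i is Some j then mpolyX int (mnm1 j) else 0.

Lemma int_eval_var (D : comNzRingType) m (v : nat -> D) i :
  (i < m)%N -> int_eval v (int_var m i) = v i.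
Proof.
by move=> im; rewrite /int_var insubT /int_eval mmapX mmap1U.
Qed.

Lemma int_eval_id m (q : mpoly m int) : int_eval (int_var m) q = q.
Proof.
rewrite [RHS](mpolyE q); apply: eq_bigr => a _.
rewrite -mul_mpolyC -[X in _ = mpolyC _ X * _]intz; congr (_ * _).
  by rewrite rmorph_int.
rewrite [RHS]mpolyXE_id /mmap1; apply: eq_bigr => i _.
by rewrite /int_var insubT // => ?; congr (mpolyX _ (mnm1 _) ^+ _); apply: val_inj.
Qed.

Lemma mpoly_int_embed m : exists h : mpoly m int -> seq (multinom m * int), injective h.
Proof.
exists (fun p => [seq (a, mcoeff a p) | a <- msupp p]).
apply: (can_inj (g := fun r => \sum_(t <- r) t.2 *: mpolyX int t.1)) => p.
by rewrite big_map /= -mpolyE.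
Qed.

Section ArtinLang.
Variables (R : realType) (n : nat).
Local Notation A := (mpoly n R).
Local Notation B := {poly A}.

Definition eval_at (x : 'I_n -> R) (t : R) (Y : B) : R := (map_poly (meval x) Y).[t].

HB.instance Definition _ x t := GRing.RMorphism.copy (eval_at x t)
  ((horner_eval t : {rmorphism {poly R} -> R}) \o map_poly (meval x)).

Definition cst_poly (r : R) : B := (mpolyC n r)%:P.
HB.instance Definition _ := GRing.RMorphism.copy cst_poly
  ((polyC : A -> B) \o (@mpolyC n R : R -> A)).

Lemma eval_at_cst x t r : eval_at x t (cst_poly r) = r.
Proof. by rewrite /eval_at /cst_poly map_polyC hornerC /= mevalC. Qed.

Section Lift.
Variable cs : seq R.
Local Notation N := (size cs).
Local Notation M := (n.+1 + size cs)%N.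

Definition base_var (i : nat) : B :=
  if (i < N)%N then cst_poly cs`_i
  else if insub (i - N)%N is Some j then (mpolyX R (mnm1 j))%:P else 'X.

Lemma lift_poly (Y : B) : (forall k, {subset [seq mcoeff a Y`_k | a <- msupp Y`_k] <= cs}) ->
  exists q : mpoly M int, int_eval base_var q = Y.
Proof.
move=> Ycs; pose Im := [set Y : B | exists q : mpoly M int, int_eval base_var q = Y].
have Im0 : Im 0 by exists 0; rewrite rmorph0.
have Im1 : Im 1 by exists 1; rewrite rmorph1.
have ImD Y1 Y2 : Im Y1 -> Im Y2 -> Im (Y1 + Y2).
  by move=> [p <-] [q <-]; exists (p + q); rewrite rmorphD.
have ImM Y1 Y2 : Im Y1 -> Im Y2 -> Im (Y1 * Y2).
  by move=> [p <-] [q <-]; exists (p * q); rewrite rmorphM.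
have ImX Y1 k : Im Y1 -> Im (Y1 ^+ k) by move=> [p <-]; exists (p ^+ k); rewrite rmorphXn.
have ImV i : (i < M)%N -> Im (base_var i).
  by move=> iM; exists (int_var M i); rewrite int_eval_var.
suff : Im Y by [].
clearbody Im.
have -> : Y = \sum_(k < size Y) (Y`_k)%:P * 'X^k.
  by rewrite -[LHS]coefK poly_def; apply: eq_bigr => k _; rewrite mul_polyC.
apply: (big_ind Im) => // k _.
apply: (ImM); last first.
  apply: (ImX); have := ImV (n + N)%N (leqnn _).
  by rewrite /base_var ltnNge leq_addl addnK insubN ?ltnn.
rewrite (mpolyE Y`_k) raddf_sum big_seq; apply: (big_ind Im) => // a aY /=.
rewrite -mul_mpolyC polyCM; apply: (ImM).
  have cN : (index (mcoeff a Y`_k) cs < N)%N.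
    by rewrite index_mem; apply: (Ycs k); apply: map_f.
  have := ImV _ (leq_trans cN (leq_addl _ _)).
  by rewrite /base_var cN nth_index // -index_mem.
rewrite mpolyXE_id rmorph_prod; apply: (big_ind Im) => // i _.
rewrite rmorphXn; apply: (ImX).
have iM : (i + N < M)%N by rewrite addSn ltnS leq_add2r ltnW.
by have := ImV _ iM; rewrite /base_var ltnNge leq_addl addnK valK.
Qed.

End Lift.

Lemma artin_lang (P : set B) (Ys : seq B) : prime_cone P ->
  exists x t, forall Y, Y \in Ys -> P Y -> 0 <= eval_at x t Y.
Proof.
move=> HP; have [PD PM Pt P1 Pp] := HP.
have Pcst r : 0 <= r -> P (cst_poly r).
  move=> r0; rewrite -(sqr_sqrtr r0) rmorphXn expr2.
  by case: (Pt (cst_poly (Num.sqrt r))) => H; [|rewrite -mulrNN]; exact: PM.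
pose row (Y : B) k := [seq mcoeff a Y`_k | a <- msupp Y`_k].
pose coefs (Y : B) := flatten [seq row Y k | k <- iota 0 (size Y)].
pose cs := flatten [seq coefs Y | Y <- Ys].
pose N := size cs; pose M := (n.+1 + N)%N.
have liftY Y : Y \in Ys -> exists q : mpoly M int, int_eval (base_var cs) q = Y.
  move=> YYs; apply: lift_poly => k c cY; apply/flattenP.
  exists (coefs Y); first exact: map_f.
  apply/flattenP; exists (row Y k); last exact: cY.
  apply: (map_f (row Y)).
  rewrite mem_iota /= add0n ltnNge; apply: contraL cY => le.
  by rewrite nth_default // msupp0.
have /choice[lf Hlf] : forall Y, exists q : mpoly M int,
    Y \in Ys -> int_eval (base_var cs) q = Y.
  move=> Y; case: (boolP (Y \in Ys)) => [/liftY[q Hq]|_]; last by exists 0.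
  by exists q.
have [h h_inj] := mpoly_int_embed M.
have [F [phi Hphi]] := prime_cone_rcf h_inj (prime_cone_preim (int_eval (base_var cs)) HP).
pose v i := phi (int_var M i).
have phiE q : phi q = int_eval v q.
  by rewrite -[in LHS](int_eval_id q) rmorph_int_eval.
have [Q HQ] := @sign_transfer F R n.+1 N [seq lf Y | Y <- Ys].
have [c cQ|u' u'E Hu'] := HQ v (fun i => cs`_i).
  pose q' : mpoly M int := int_eval (int_var M) c.
  have vE : int_eval v c = phi q'.
    by rewrite /q' rmorph_int_eval.
  set r : R := int_eval _ c.
  have psiE : int_eval (base_var cs) q' = cst_poly r.
    rewrite /r /q' !rmorph_int_eval; apply: int_eval_eq => i iN.
    by rewrite /= int_eval_var ?(leq_trans iN) ?leq_addl // /base_var iN.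
  have Pr : P (cst_poly r) <-> 0 <= phi q' by rewrite -Hphi /= psiE.
  have psiN : int_eval (base_var cs) (- q') = cst_poly (- r).
    exact: etrans (rmorphN _ _) (etrans (congr1 -%R psiE) (esym (rmorphN cst_poly r))).
  have PNr : P (cst_poly (- r)) <-> 0 <= - phi q'.
    have := Hphi (- q'); rewrite (rmorphN phi) => H.
    by apply: iff_trans H; rewrite /= psiN.
  have nP (z : R) : z < 0 -> ~ P (cst_poly z).
    move=> z0 Pz; apply: P1; rewrite -(rmorphN1 cst_poly).
    have -> : - 1 = z * (- z^-1) by rewrite mulrN divff ?lt_eqF.
    rewrite rmorphM; apply: PM => //; apply: Pcst.
    by rewrite oppr_ge0 invr_le0 ltW.
  rewrite vE; case: (ltrgt0P r) => [r0|r0|r0].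
  - rewrite !gtr0_sgz // lt_def; apply/andP; split; last by apply/Pr/Pcst/ltW.
    apply/eqP => e; have := nP (- r); rewrite oppr_lt0 => /(_ r0); apply.
    by apply/PNr; rewrite e oppr0.
  - rewrite !ltr0_sgz // ltNge; apply/negP => /Pr; exact: nP.
  - rewrite r0 sgz0; apply/eqP; rewrite sgz_eq0 eq_le; apply/andP; split.
      by rewrite -oppr_ge0; apply/PNr; rewrite r0 oppr0; exact: Pcst.
    by apply/Pr; rewrite r0; exact: Pcst.
pose x (j : 'I_n) := u' (j + N)%N; pose t := u' (n + N)%N.
exists x, t => Y YYs PY; rewrite -(Hlf Y YYs) rmorph_int_eval.
have -> : int_eval (fun i => eval_at x t (base_var cs i)) (lf Y) = int_eval u' (lf Y).
  apply: int_eval_eq => i iM; rewrite /base_var; case: ltnP => iN.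
    by rewrite eval_at_cst u'E.
  case: insubP => [j _ je|]; rewrite /eval_at.
    by rewrite map_polyC hornerC /= mevalXU /x je subnK.
  rewrite -leqNgt map_polyX hornerX /t => nj; congr u'.
  apply/eqP; rewrite eqn_leq; apply/andP; split; last by rewrite -ltnS -addSn.
  by rewrite addnC -leq_subRL.
have /Hu' e : lf Y \in [seq lf Y | Y <- Ys] by exact: map_f.
by rewrite -sgz_ge0 -e sgz_ge0 -phiE -Hphi /= Hlf.
Qed.

End ArtinLang.

(** * Points of the semialgebraic set near the weight vector *)

Lemma nat_diff_approx (R : realType) (z : R) :
  exists a c : nat, z - 2 <= a%:R - c%:R < z.
Proof.
have [le lt] : (Num.floor z)%:~R <= z /\ z < (Num.floor z)%:~R + 1.
  by split; [exact: floor_le_tmp|have := floorD1_gt z; rewrite intrD].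
have [a [c e]] : exists a c : nat, (Num.floor z)%:~R - 1 = a%:R - c%:R :> R.
  case: (Num.floor z) => m; first by exists m, 1%N.
  by exists 0%N, m.+2; rewrite NegzE rmorphN /= -pmulrn -(natr1 m.+1) sub0r opprD.
by exists a, c; rewrite -e; apply/andP; split; lra.
Qed.

Section Constraints.
Variables (R : realType) (n : nat) (w : 'rV[R]_n).
Local Notation wd := (wdot w).

Lemma wdot1 i : wd (mnm1 i) = w ord0 i.
Proof.
rewrite /wdot (bigD1 i) //= mnm1E eqxx mulr1 big1 ?addr0 // => j ji.
by rewrite mnm1E eq_sym (negPf ji) mulr0.
Qed.

Lemma top_form_binomial c a k c' a' k' d : wd a + k%:R = d -> wd a' + k'%:R < d ->
  weights_in w (fun v => v <= d) (wterm c a k + wterm c' a' k') /\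
  top_form w d (wterm c a k + wterm c' a' k') = c *: mpolyX R a.
Proof.
move=> e lt; split.
  by apply: weights_inD; apply: weights_in_term; rewrite ?e // ltW.
by rewrite top_formD !top_form_term e eqxx lt_eqF // addr0.
Qed.

Lemma top_form_polyC (f : mpoly n R) : weights_in w (fun v => v <= deg_w w f) f%:P /\
  top_form w (deg_w w f) f%:P = in_w w f.
Proof.
split.
  move=> k; rewrite coefC; case: eqP => [->|_]; last exact: wdeg_in0.
  by apply: wdeg_in_sub (@wdeg_in_deg_w _ _ w f) => v; rewrite addr0.
by rewrite (@top_form_widen _ _ w _ _ 1) ?size_polyC_leq1 // big_ord1 coefC subr0.
Qed.

Lemma eval_at_term (x : 'I_n -> R) t c (a : multinom n) k :
  eval_at x t (wterm c a k) = c * meval x (mpolyX R a) * t ^+ k.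
Proof.
by rewrite /eval_at /wterm rmorphM /= map_polyC map_polyXn hornerM hornerC hornerXn /= mevalZ.
Qed.

Lemma eval_at_polyC (x : 'I_n -> R) t (f : mpoly n R) : eval_at x t f%:P = meval x f.
Proof. by rewrite /eval_at map_polyC hornerC. Qed.

Lemma meval_powX (x : 'I_n -> R) i m : meval x (mpolyX R (mnm_muln (mnm1 i) m)) = x i ^+ m.
Proof. by rewrite -mpolyXn rmorphXn /= mevalXU. Qed.

End Constraints.

Section LogBounds.
Variables (R : realType) (x t : R) (N a c : nat).
Hypotheses (N0 : (0 < N)%N) (t1 : 1 < t).

Let t0 : 0 < t. Proof. exact: lt_trans t1. Qed.
Let lnt0 : 0 < ln t. Proof. exact: ln_gt0. Qed.

Let ln_monomial : x != 0 ->
  ln (x ^+ (2 * N) * t ^+ (2 * c)) = 2 * (N%:R * ln `|x| + c%:R * ln t).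
Proof.
move=> x0; have x1 : 0 < `|x| by rewrite normr_gt0.
have -> : x ^+ (2 * N) = `|x| ^+ (2 * N) by rewrite !exprM real_normK ?num_real.
by rewrite lnM ?posrE ?exprn_gt0 // !lnXn // -!(mulr_natl (ln _)) !natrM; ring.
Qed.

Let ln_pow : ln (t ^+ (2 * a)) = 2 * (a%:R * ln t).
Proof. by rewrite lnXn // -(mulr_natl (ln _)) natrM mulrA. Qed.

Let monomial_gt0 : x != 0 -> 0 < x ^+ (2 * N) * t ^+ (2 * c).
Proof.
move=> x0; apply: mulr_gt0; last by rewrite exprn_gt0.
by rewrite exprM exprn_gt0 // lt_def sqrf_eq0 x0 sqr_ge0.
Qed.

Lemma log_lower_bound : t ^+ (2 * a) <= x ^+ (2 * N) * t ^+ (2 * c) ->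
  x != 0 /\ (a%:R - c%:R) / N%:R <= ln `|x| / ln t.
Proof.
move=> le; have x0 : x != 0.
  apply: contraTneq le => ->; rewrite expr0n muln_eq0 /= -leqn0 leqNgt N0 /= mul0r.
  by rewrite -ltNge exprn_gt0.
split=> //; move: le; rewrite -ler_ln ?posrE ?exprn_gt0 ?monomial_gt0 //.
rewrite ln_monomial // ln_pow ler_pM2l // => le.
rewrite ler_pdivrMr ?ltr0n // mulrAC ler_pdivlMr //; lra.
Qed.

Lemma log_upper_bound : x != 0 -> x ^+ (2 * N) * t ^+ (2 * c) <= t ^+ (2 * a) ->
  ln `|x| / ln t <= (a%:R - c%:R) / N%:R.
Proof.
move=> x0; rewrite -ler_ln ?posrE ?exprn_gt0 ?monomial_gt0 //.
rewrite ln_monomial // ln_pow ler_pM2l // => le.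
rewrite ler_pdivlMr ?ltr0n // mulrAC ler_pdivrMr //; lra.
Qed.

End LogBounds.

Lemma K_star_point_near (R : realType) (n s : nat) (g : 'I_s -> mpoly n R)
    (I : set (mpoly n R)) (w : 'rV[R]_n) (N : nat) (M : R) :
  is_ideal I -> Trop I w ->
  preorder_basis (fun i : 'I_s => in_w w (g i)) (in_w_ideal w I) ->
  (0 < N)%N -> 1 < M ->
  exists (x : 'rV[R]_n) (t : R), [/\ K_star I g x, M <= t
    & forall i, `|ln `|x ord0 i| / ln t - w ord0 i| <= 2 / N%:R].
Proof.
move=> HI Tw PO N0 M1.
have /choice[lo Hlo] : forall i : 'I_n, exists ac : nat * nat,
    N%:R * w ord0 i - 2 <= ac.1%:R - ac.2%:R < N%:R * w ord0 i.
  by move=> i; have [a [c H]] := nat_diff_approx (N%:R * w ord0 i); exists (a, c).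
have /choice[hi Hhi] : forall i : 'I_n, exists bd : nat * nat,
    N%:R * w ord0 i < bd.1%:R - bd.2%:R <= N%:R * w ord0 i + 2.
  move=> i; have [a [c H]] := nat_diff_approx (- (N%:R * w ord0 i)); exists (c, a).
  by move: H => /andP[? ?] /=; apply/andP; split; lra.
pose pw (i : 'I_n) : multinom n := mnm_muln (mnm1 i) (2 * N).
pose c (k : option (bool * 'I_n)) : {poly mpoly n R} := match k with
  | None => wterm 1 mnm0 1 + wterm (- M) mnm0 0
  | Some (true, i) => wterm 1 (pw i) (2 * (lo i).2) + wterm (- 1) mnm0 (2 * (lo i).1)
  | Some (false, i) => wterm 1 mnm0 (2 * (hi i).1) + wterm (- 1) (pw i) (2 * (hi i).2)
  end.
pose gc (k : option (bool * 'I_n)) : R := match k with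
  | None => 1
  | Some (true, i) => (2 * N)%:R * w ord0 i + (2 * (lo i).2)%:R
  | Some (false, i) => (2 * (hi i).1)%:R
  end.
pose alp (k : option (bool * 'I_n)) : multinom n := match k with
  | Some (true, i) => mnm_muln (mnm1 i) N
  | _ => mnm0
  end.
have wpw i : wdot w (pw i) = (2 * N)%:R * w ord0 i.
  by rewrite wdot_muln wdot1.
have Hc k : weights_in w (fun v => v <= gc k) (c k) /\
    top_form w (gc k) (c k) = mpolyX R (alp k) ^+ 2.
  have sq0 : (1 : R) *: mpolyX R mnm0 = mpolyX R (mnm0 : multinom n) ^+ 2.
    by rewrite scale1r mpolyX0 expr1n.
  case: k => [[[] i]|] /=.
  - rewrite mpolyXn; have -> : mnm_muln (mnm_muln (mnm1 i) N) 2 = pw i.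
      by apply/mnmP => j; rewrite !mulmnE -mulnA (mulnC N).
    rewrite -[mpolyX R (pw i)]scale1r; apply: top_form_binomial; rewrite ?wpw ?wdot0 //.
    by have /andP[_] := Hlo i; rewrite !natrM; lra.
  - rewrite -sq0; apply: top_form_binomial; rewrite ?wpw ?wdot0 ?add0r //.
    by have /andP[+ _] := Hhi i; rewrite !natrM; lra.
  - by rewrite -sq0; apply: top_form_binomial; rewrite ?wdot0 ?add0r // ltr01.
pose G (i : 'I_s + option (bool * 'I_n)) : {poly mpoly n R} :=
  match i with inl j => (g j)%:P | inr k => c k end.
pose gam (i : 'I_s + option (bool * 'I_n)) : R :=
  match i with inl j => deg_w w (g j) | inr k => gc k end.
have proper : ~ preorder_mod G (poly_ideal I) (- 1).
  apply: (@descent_proper _ _ w I HI s _ _ G gam alp PO Tw).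
  - by case=> [j|k]; [case: (top_form_polyC w (g j))|case: (Hc k)].
  - by move=> j; case: (top_form_polyC w (g j)).
  - by move=> k; case: (Hc k).
have BI := poly_ideal_ideal HI.
have [P HP TP] := preordering_prime_cone (preorder_mod_preordering BI proper).
have [fs fsI Ifs] := mpoly_ideal_fg HI.
have [x [t Hxt]] := artin_lang ([seq f%:P | f <- fs] ++ [seq (- f)%:P | f <- fs] ++
  [seq G i | i <- enum {: 'I_s + option (bool * 'I_n)}]) HP.
have HG i : 0 <= eval_at x t (G i).
  apply: Hxt; last by apply: TP; exact: preorder_mod_gen.
  by rewrite !mem_cat map_f ?orbT // mem_enum.
have Mt : M <= t.
  have := HG (inr None); rewrite /= rmorphD /= !eval_at_term mpolyX0 meval1 expr1 expr0; lra.
have t1 : 1 < t by apply: lt_le_trans Mt.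
have xlo i : x i != 0 /\ ((lo i).1%:R - (lo i).2%:R) / N%:R <= ln `|x i| / ln t.
  apply: log_lower_bound => //.
  have := HG (inr (Some (true, i))).
  by rewrite /= rmorphD /= !eval_at_term mpolyX0 meval1 meval_powX; lra.
have xhi i : ln `|x i| / ln t <= ((hi i).1%:R - (hi i).2%:R) / N%:R.
  apply: log_upper_bound => //; first by case: (xlo i).
  have := HG (inr (Some (false, i))).
  by rewrite /= rmorphD /= !eval_at_term mpolyX0 meval1 meval_powX; lra.
exists (\row_j x j), t; split=> //.
- have mE f : meval ((\row_j x j) ord0) f = meval x f.
    by apply: meval_eq => j; rewrite mxE.
  split=> [i|f If|i]; rewrite ?mxE ?mE; first by case: (xlo i).
    pose Z := [set f | meval x f = 0].
    have /(_ f (Ifs f If)) : ideal_gen [set` fs] `<=` Z.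
      apply: ideal_gen_min.
        by split=> [|a b|h a]; rewrite /Z /= ?meval0 // ?mevalD ?mevalM => ->
          ; rewrite ?mulr0 // add0r.
      move=> h hfs; apply/eqP; rewrite eq_le; apply/andP; split.
        rewrite -oppr_ge0 -mevalN -(eval_at_polyC x t); apply: Hxt.
          by rewrite !mem_cat (map_f (fun f => (- f)%:P)) ?orbT.
        apply: TP; apply: preorder_mod_ideal => k; rewrite coefC.
        have [I0 _ IM] := HI; case: eqP => _ //.
        by rewrite -mulN1r; apply: IM; exact: fsI.
      rewrite -(eval_at_polyC x t); apply: Hxt; first by rewrite mem_cat map_f.
      by apply: TP; apply: preorder_mod_ideal => k; rewrite coefC; case: eqP => _;
        [exact: fsI|case: HI].
    by [].
  by have := HG (inl i); rewrite /= eval_at_polyC.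
- move=> i; rewrite mxE; have [_ l1] := xlo i; have h1 := xhi i.
  have N1 : 0 < N%:R :> R by rewrite ltr0n.
  have /andP[l2 _] := Hlo i; have /andP[_ h2] := Hhi i.
  rewrite ler_norml; apply/andP; split.
    rewrite lerBrDr; apply: le_trans l1; rewrite ler_pdivlMr //.
    by rewrite mulrDl mulNr divfK ?gt_eqF //; lra.
  rewrite lerBlDr; apply: (le_trans h1); rewrite ler_pdivrMr //.
  by rewrite mulrDl divfK ?gt_eqF //; lra.
Qed.

Theorem theorem2p3 (R : realType) (n s : nat) (g : 'I_s -> mpoly n R)
    (I : set (mpoly n R)) (w : 'rV[R]_n) :
  is_ideal I ->
  Trop I w ->
  real_radical (in_w_ideal w I) ->
  preorder_basis (fun i : 'I_s => in_w w (g i)) (in_w_ideal w I) ->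
  log_limit (K_star I g) w.
Proof.
move=> HI Tw _ PO.
have /choice[xt Hxt] : forall k : nat, exists xt : 'rV[R]_n * R,
    [/\ K_star I g xt.1, k.+2%:R <= xt.2
      & forall i, `|ln `|xt.1 ord0 i| / ln xt.2 - w ord0 i| <= 2 / k.+1%:R].
  move=> k; have [||x [t H]] := @K_star_point_near R n s g I w k.+1 k.+2%:R HI Tw PO => //.
    by rewrite ltr1n.
  by exists (x, t).
have t1 k : 1 < (xt k).2.
  by have [_ + _] := Hxt k; apply: lt_le_trans; rewrite ltr1n.
have small (e : R) : 0 < e -> \forall k \near \oo, 2 / k.+1%:R < e.
  move=> e0; near=> k; rewrite ltr_pdivrMr ?ltr0n // mulrC -ltr_pdivrMr //.
  apply: (@le_lt_trans _ _ k%:R); last by rewrite ltr_nat.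
  by near: k; exact: nbhs_infty_ger.
exists (fun k => map_mx (fun c : R => `|c|) (xt k).1), (fun k => (xt k).2^-1); split.
- by move=> k; exists (xt k).1 => //; case: (Hxt k).
- by move=> k; rewrite invr_gt0 invf_lt1 ?(lt_trans ltr01 (t1 k)) ?t1.
- apply/cvgrPdist_lt => e /small He; near=> k.
  have tk0 : 0 < (xt k).2 by apply: lt_trans (t1 k).
  rewrite sub0r normrN gtr0_norm ?invr_gt0 //.
  apply: (@le_lt_trans _ _ (2 / k.+1%:R)); last by near: k.
  have [_ le _] := Hxt k; rewrite -(mul1r _^-1) ler_pM // ?invr_ge0 ?(ltW tk0) ?ler1n //.
  by rewrite lef_pV2 ?posrE ?ltr0n // (le_trans _ le) // ler_nat.
- apply/cvg_ballP => e e0; have He := small _ e0; near=> k.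
  split=> // i j; rewrite !mxE ord1 invrK /log_base /ball /=.
  rewrite distrC; have [_ _ H] := Hxt k; apply: le_lt_trans (H j) _.
  by near: k.
Unshelve. all: by end_near. Qed.
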